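(* Let $T\in\mathcal{D}'_{L^\infty}$. The following propositions are equivalent: 1. There exist $n\in\mathbb{Z}_+$ and functions $f_0,\dots,f_n\in\mathcal{C}_{aa}$ such that $T=\sum_{j=0}^{n} f_j^{(j)}$, the derivatives being taken in the sense of distributions. 2. For every sequence $(s_m)_{m\in\mathbb{N}}\subset\mathbb{R}$ there exists a subsequence $(s_{m_k})_k$ such that $S:=\lim_{k\to+\infty}\tau_{s_{m_k}}T$ exists in $\mathcal{D}'$ and $\lim_{l\to+\infty}\tau_{-s_{m_l}}S=T$ in $\mathcal{D}'$. 3. $T\ast\varphi\in\mathcal{C}_{aa}$ for all $\varphi\in\mathcal{D}$.
   Context: All functions and distributions are complex-valued and defined on $\mathbb{R}$; $\mathcal{D}$ is the space of smooth compactly supported functions and $\mathcal{D}'$ the space of distributions. A continuous function $f:\mathbb{R}\to\mathbb{C}$ is almost automorphic if for every real sequence $(s_m)_{m\in\mathbb{N}}$ there is a subsequence $(s_{m_k})_k$ such that $g(x):=\lim_{k\to+\infty}f(x+s_{m_k})$ is well-defined for every $x\in\mathbb{R}$ and $\lim_{k\to+\infty}g(x-s_{m_k})=f(x)$ for every $x\in\mathbb{R}$. $\mathcal{C}_{aa}$ denotes the space of almost automorphic functions. $\mathcal{D}_{L^1}=\{\varphi\in\mathcal{C}^\infty:\ \varphi^{(i)}\in L^1\ \forall i\in\mathbb{Z}_+\}$ is a Fréchet space for the norms $|\varphi|_{m,1}=\sum_{i=0}^m\|\varphi^{(i)}\|_{L^1}$, $m\in\mathbb{Z}_+$, and $\mathcal{D}$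 is dense in it. $\mathcal{D}'_{L^\infty}$ is the topological dual of $\mathcal{D}_{L^1}$, regarded as a subspace of $\mathcal{D}'$; its elements are called bounded distributions. For $\varphi\in\mathcal{D}$, $(T\ast\varphi)(x)=\langle T,\varphi(x-\cdot)\rangle$. For $h\in\mathbb{R}$, $\tau_h T$ is defined by $\langle\tau_hT,\varphi\rangle=\langle T,\tau_{-h}\varphi\rangle$, where $\tau_{-h}\varphi(x)=\varphi(x-h)$; for functions $\tau_hf=f(\cdot+h)$. *)

(* Defs.v *)
From HB Require Import structures.
From mathcomp Require Import all_boot all_order all_algebra.
From mathcomp Require Import complex.
From mathcomp Require Import all_classical all_reals all_analysis.
From mathcomp Require Import measurable_realfun.

Set Implicit Arguments.
Unset Strict Implicit.
Unset Printing Implicit Defensive.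

Import Order.TTheory GRing.Theory Num.Theory.
Import numFieldNormedType.Exports.

Local Open Scope classical_set_scope.
Local Open Scope ring_scope.
Local Open Scope complex_scope.

(* [Rcomplex R] is the alias of [R[i]] which [complex.v] equips with the
   [R]-module structure and the [R]-valued modulus.  We add the topology of the
   modulus: continuity, limits and derivatives of complex-valued functions are
   taken in the real normed module [Rcomplex R], while [R[i]] is used as the
   field of scalars. *)
Section Rcomplex_normedModType.
Variable R : realType.

Lemma Rcomplex_normrZ (l : R) (z : Rcomplex R) : `|l *: z| = `|l| * `|z|.
Proof.
case: z => a b; rewrite /Num.norm/= !exprMn -mulrDr sqrtrM ?sqr_ge0//.
by rewrite sqrtr_sqr.
Qed.

HB.instance Definition _ :=
  PseudoMetric.copy (Rcomplex R) (pseudoMetric_normed (Rcomplex R)).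
HB.instance Definition _ := isPointed.Build (Rcomplex R) 0.
HB.instance Definition _ :=
  NormedZmod_PseudoMetric_eq.Build R (Rcomplex R) erefl.
HB.instance Definition _ :=
  PseudoMetricNormedZmod_Lmodule_isNormedModule.Build R (Rcomplex R)
    Rcomplex_normrZ.

Lemma Rcomplex_normrM (a z : Rcomplex R) :
  `|a * z : Rcomplex R| = `|a| * `|z|.
Proof. exact: Normc.normcM. Qed.

Definition Rcomplex_mull (a z : Rcomplex R) : Rcomplex R := a * z.

Lemma Rcomplex_mull_is_linear (a : Rcomplex R) : linear (Rcomplex_mull a).
Proof.
move=> k u v; rewrite /Rcomplex_mull mulrDr; congr (_ + _).
case: a u => a1 a2 [u1 u2]; apply/eqP; rewrite eq_complex/= !mulrBr mulrDr.
by rewrite !(mulrCA _ k) !eqxx.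
Qed.
HB.instance Definition _ (a : Rcomplex R) :=
  GRing.isLinear.Build R (Rcomplex R) (Rcomplex R) _ (Rcomplex_mull a)
    (Rcomplex_mull_is_linear a).

Lemma Rcomplex_mull_continuous (a : Rcomplex R) :
  continuous (Rcomplex_mull a).
Proof.
apply: bounded_linear_continuous; apply/linear_boundedP.
near=> r => z; rewrite Rcomplex_normrM ler_wpM2r//.
Unshelve. all: by end_near. Qed.

End Rcomplex_normedModType.

Section smooth_functions.
Variable R : realType.
Implicit Types (f g : R -> R[i]) (K : set R).

Definition cderivn n f : R -> R[i] := derive1n n (f : R -> Rcomplex R).

Definition smooth f :=
  forall n x, derivable (cderivn n f : R -> Rcomplex R) x 1.

Definition supp f : set R := closure [set x | f x != 0].

Definition cabs f (x : R) : R := `|f x : Rcomplex R|.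

Definition L1norm f : \bar R :=
  (\int[@lebesgue_measure R]_x (cabs f x)%:E)%E.

Definition supnorm f : \bar R := ereal_sup (range (fun x => (cabs f x)%:E)).

Definition cintegral f : R[i] :=
  (\int[@lebesgue_measure R]_x complex.Re (f x)) +i*
  (\int[@lebesgue_measure R]_x complex.Im (f x)).

Lemma cderivnS n f : cderivn n.+1 f = cderivn 1 (cderivn n f).
Proof. by []. Qed.

Lemma smooth_continuous f n : smooth f ->
  continuous (cderivn n f : R -> Rcomplex R).
Proof. by move=> sf x; exact/differentiable_continuous/derivable1_diffP. Qed.

Lemma cabs_ge0 f x : 0 <= cabs f x.
Proof. exact: normr_ge0. Qed.

Lemma cabs_continuous f : continuous (f : R -> Rcomplex R) ->
  continuous (cabs f).
Proof.
by move=> cf x; apply: continuous_comp (cf x) (@norm_continuous _ _ _).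
Qed.

Lemma is_derive_lin (a : R[i]) f g x :
  derivable (f : R -> Rcomplex R) x 1 -> derivable (g : R -> Rcomplex R) x 1 ->
  derivable (a *: f + g : R -> Rcomplex R) x 1 /\
  cderivn 1 (a *: f + g) x = a * cderivn 1 f x + cderivn 1 g x.
Proof.
move=> df dg.
have da : differentiable (Rcomplex_mull (a : Rcomplex R))
    (f x : Rcomplex R).
  exact/linear_differentiable/Rcomplex_mull_continuous.
have daf : differentiable
    (Rcomplex_mull (a : Rcomplex R) \o (f : R -> Rcomplex R)) x.
  by apply: differentiable_comp => //; exact/derivable1_diffP.
have -> : (a *: f + g : R -> Rcomplex R) =
  (Rcomplex_mull (a : Rcomplex R) \o (f : R -> Rcomplex R) :
     R -> Rcomplex R) + (g : R -> Rcomplex R) by [].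
split; first by apply: derivableD => //; exact/derivable1_diffP.
rewrite /cderivn/= !derive1E deriveD//; last exact/derivable1_diffP.
congr (_ + _); rewrite deriveE// diff_comp//; last exact/derivable1_diffP.
rewrite /= diff_lin; last exact: Rcomplex_mull_continuous.
by rewrite deriveE//; exact/derivable1_diffP.
Qed.

Lemma cderivn_lin n (a : R[i]) f g : smooth f -> smooth g ->
  cderivn n (a *: f + g) = a *: cderivn n f + cderivn n g.
Proof.
move=> sf sg; elim: n => // n IH; apply/funext => x.
by rewrite cderivnS IH (is_derive_lin _ (sf n x) (sg n x)).2.
Qed.

Lemma smooth_lin (a : R[i]) f g : smooth f -> smooth g -> smooth (a *: f + g).
Proof.
move=> sf sg n x; rewrite cderivn_lin//.
by have [] := is_derive_lin a (sf n x) (sg n x).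
Qed.

Lemma cderivn0 n : cderivn n 0 = 0.
Proof.
elim: n => // n IH; rewrite cderivnS IH; apply/funext => x.
by rewrite /cderivn/= derive1E derive_cst.
Qed.

Lemma smooth0 : smooth 0.
Proof. by move=> n x; rewrite cderivn0; exact: derivable_cst. Qed.

Lemma cderivnD m n f : cderivn m (cderivn n f) = cderivn (m + n) f.
Proof. by rewrite /cderivn /derive1n iterD. Qed.

Lemma smooth_cderivn n f : smooth f -> smooth (cderivn n f).
Proof. by move=> sf m x; rewrite cderivnD. Qed.

Lemma is_derive_affine (s c : R) f x :
  derivable (f : R -> Rcomplex R) (s * x + c) 1 ->
  derivable ((fun y => f (s * y + c)) : R -> Rcomplex R) x 1 /\
  cderivn 1 (fun y => f (s * y + c)) x =
    (s *: (cderivn 1 f (s * x + c) : Rcomplex R)).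
Proof.
move=> /derivable1_diffP df.
have dg : is_derive x 1 (fun y : R => s * y + c) s.
  by apply: is_derive_eq; rewrite addr0 [LHS]mulr1.
have dg' : differentiable (fun y : R => s * y + c) x.
  by apply/derivable1_diffP; exact: ex_derive.
have dfg : differentiable
    ((f : R -> Rcomplex R) \o (fun y : R => s * y + c)) x.
  exact: differentiable_comp.
split; first exact/derivable1_diffP.
have -> : cderivn 1 f (s * x + c) = 'D_1 (f : R -> Rcomplex R) (s * x + c).
  by rewrite /cderivn/= derive1E.
rewrite /cderivn/= derive1E [LHS]deriveE// diff_comp//=.
have -> : 'd (fun y : R => s * y + c) x 1 = s.
  by rewrite -deriveE//; exact: derive_val.
rewrite deriveE// -linearZ.
by rewrite [_ *: 1]mulr1.
Qed.

Lemma cderivn_affine n (s c : R) f : smooth f ->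
  cderivn n (fun y => f (s * y + c)) =
  (fun y => s ^+ n *: (cderivn n f (s * y + c) : Rcomplex R)).
Proof.
move=> sf; elim: n => [|n IH].
  by apply/funext => y; rewrite expr0 scale1r.
apply/funext => x; rewrite cderivnS IH exprSr -scalerA.
have [dF <-] := is_derive_affine (sf n (s * x + c)).
rewrite /cderivn/= !derive1E.
exact: (@deriveZ _ _ _ ((fun y => cderivn n f (s * y + c)) : R -> Rcomplex R)).
Qed.

Lemma smooth_affine (s c : R) f : smooth f -> smooth (fun y => f (s * y + c)).
Proof.
move=> sf n x; rewrite cderivn_affine//; apply: derivableZ.
by have [] := is_derive_affine (sf n (s * x + c)).
Qed.

Lemma compact_suppP f :
  compact (supp f) <-> exists M : R, forall x, M < `|x| -> f x = 0.
Proof.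
split=> [/compact_bounded[M [_ /(_ (M + 1))]]|[M fM]].
  rewrite ltrDl ltr01 => /(_ isT) sM; exists (M + 1) => x Mx.
  apply/eqP/negP => /negP fx0.
  have := sM x (@subset_closure _ [set z | f z != 0] x fx0).
  by rewrite /= leNgt Mx.
apply: (@subclosed_compact _ _ `[- M, M]); [exact: closed_closure| |].
  exact: segment_compact.
have /closure_id -> : closed [set` `[- M, M]] by exact: itv_closed.
apply: closure_subset => x /= fx0; rewrite in_itv/= -ler_norml leNgt.
by apply/negP => /fM /eqP; rewrite (negbTE fx0).
Qed.

Lemma cderivn_eq0 n f (M : R) : (forall x, M < `|x| -> f x = 0) ->
  forall x, M < `|x| -> cderivn n f x = 0.
Proof.
move=> fM; elim: n => // n IH x Mx; rewrite cderivnS /cderivn/= derive1E.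
rewrite (@near_eq_derive _ _ _ _ (cst 0)) ?derive_cst//.
have : open [set y : R | M < `|y|].
  have := @open_comp R R Num.norm [set y | y > M]
    (fun x _ => @norm_continuous R R x).
  by apply; exact: open_gt.
by move=> oM; near=> y; apply: IH; near: y; exact: open_nbhs_nbhs.
Unshelve. all: by end_near. Qed.

Lemma cabs_measurable f : continuous (f : R -> Rcomplex R) ->
  measurable_fun [set: R] (EFin \o cabs f).
Proof.
move=> cf; apply/measurable_EFinP.
by apply: continuous_measurable_fun; exact: cabs_continuous.
Qed.

Lemma L1norm_lin_lty (a : R[i]) f g :
  continuous (f : R -> Rcomplex R) -> continuous (g : R -> Rcomplex R) ->
  (L1norm f < +oo)%E -> (L1norm g < +oo)%E -> (L1norm (a *: f + g)%R < +oo)%E.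
Proof.
move=> cf cg finf fing.
have cafg : continuous (a *: f + g : R -> Rcomplex R).
  move=> x; apply: (@continuousD _ _ _
    (Rcomplex_mull (a : Rcomplex R) \o (f : R -> Rcomplex R)) g) => //.
  - exact: continuous_comp (cf x) (@Rcomplex_mull_continuous _ _ _).
  - exact: cg.
have pos h x : (0 <= (cabs h x)%:E)%E by rewrite lee_fin cabs_ge0.
have apos : (0 <= `|a : Rcomplex R|%:E)%E by rewrite lee_fin normr_ge0.
apply: (@le_lt_trans _ _ (`|a : Rcomplex R|%:E * L1norm f + L1norm g)%E);
    last first.
  by rewrite lte_add_pinfty// lte_mul_pinfty.
rewrite /L1norm -ge0_integralZl_EFin//; last exact: cabs_measurable.
rewrite -ge0_integralD//=; last 3 first.
- by move=> x _; rewrite mule_ge0.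
- by apply: measurable_funeM; exact: cabs_measurable.
- exact: cabs_measurable.
apply: ge0_le_integral => //=.
- exact: cabs_measurable.
- apply: emeasurable_funD; [apply: measurable_funeM|];
  exact: cabs_measurable.
- move=> x _; rewrite -EFinM -EFinD lee_fin /cabs -Rcomplex_normrM.
  exact: (@ler_normD _ (Rcomplex R)).
Qed.

Lemma L1norm0 : L1norm 0 = 0%E.
Proof.
rewrite /L1norm; under eq_integral do rewrite /cabs [X in `|X|]/= normr0.
exact: integral0.
Qed.

Lemma compact_supp_L1norm f :
  continuous (f : R -> Rcomplex R) -> compact (supp f) -> (L1norm f < +oo)%E.
Proof.
move=> cf csf.
have /integrableP[_] :
    (@lebesgue_measure R).-integrable (supp f) (EFin \o cabs f).
  apply: continuous_compact_integrable => //.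
  exact/continuous_subspaceT/cabs_continuous.
apply: le_lt_trans; rewrite [leRHS]integral_mkcond.
apply: ge0_le_integral => //=.
- by move=> x _; rewrite lee_fin cabs_ge0.
- exact: cabs_measurable.
- apply/(measurable_restrictT _ _).1.
    by apply: closed_measurable; exact: closed_closure.
  apply: measurable_funTS; under eq_fun do rewrite (ger0_norm (cabs_ge0 _ _)).
  exact: cabs_measurable.
- move=> x _; rewrite patchE; case: ifPn => [_|xf].
    by rewrite lee_fin ler_norm.
  have fx0 : f x = 0.
    apply/eqP/negP => /negP fx0; move/negP: xf; apply.
    by rewrite inE; exact: subset_closure.
  by rewrite /cabs fx0 normr0.
Qed.

End smooth_functions.

Section test_functions.
Variable R : realType.

Definition test_set : set (R -> R[i]) :=
  [set f | smooth f /\ compact (supp f)].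
Definition DL1_set : set (R -> R[i]) :=
  [set f | smooth f /\ forall i, (L1norm (cderivn i f) < +oo)%E].

Definition in_test : {pred R -> R[i]} := fun f => f \in test_set.
Definition in_DL1 : {pred R -> R[i]} := fun f => f \in DL1_set.

Lemma test_submod_closed : submod_closed in_test.
Proof.
split=> [|a f g].
  rewrite unfold_in; apply/mem_set; split; first exact: smooth0.
  by apply/compact_suppP; exists 0.
rewrite !unfold_in !inE => -[sf /compact_suppP[M fM]] [sg /compact_suppP[N gN]].
split; first exact: smooth_lin.
apply/compact_suppP; exists (Num.max M N) => x; rewrite gt_max => /andP[Mx Nx].
rewrite (_ : (a *: f + g) x = a * f x + g x)//.
by rewrite fM// gN// mulr0 addr0.
Qed.
HB.instance Definition _ :=
  GRing.isSubmodClosed.Build R[i] (R -> R[i]) in_test test_submod_closed.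

Lemma DL1_submod_closed : submod_closed in_DL1.
Proof.
split=> [|a f g].
  rewrite unfold_in; apply/mem_set; split; first exact: smooth0.
  by move=> i; rewrite cderivn0 L1norm0 ltry.
rewrite !unfold_in !inE => -[sf L1f] [sg L1g]; split; first exact: smooth_lin.
move=> i; rewrite cderivn_lin//.
by apply: L1norm_lin_lty => //; exact: smooth_continuous.
Qed.
HB.instance Definition _ :=
  GRing.isSubmodClosed.Build R[i] (R -> R[i]) in_DL1 DL1_submod_closed.

End test_functions.

Record testfun (R : realType) := Testfun {
  testfun_val :> R -> R[i] ;
  testfun_prop : testfun_val \in @in_test R }.
HB.instance Definition _ (R : realType) :=
  [isSub of testfun R for @testfun_val R].
HB.instance Definition _ (R : realType) := [Choice of testfun R by <:].
HB.instance Definition _ (R : realType) :=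
  [SubChoice_isSubLmodule of testfun R by <:].

Record DL1 (R : realType) := MkDL1 {
  DL1_val :> R -> R[i] ;
  DL1_prop : DL1_val \in @in_DL1 R }.
HB.instance Definition _ (R : realType) := [isSub of DL1 R for @DL1_val R].
HB.instance Definition _ (R : realType) := [Choice of DL1 R by <:].
HB.instance Definition _ (R : realType) :=
  [SubChoice_isSubLmodule of DL1 R by <:].

Section test_function_operations.
Variable R : realType.
Implicit Types (u : testfun R) (x h : R) (j : nat).

Lemma testfunP u : smooth u /\ compact (supp u).
Proof. by have := testfun_prop u; rewrite unfold_in inE. Qed.

Lemma deriv_test_subproof j u : cderivn j u \in @in_test R.
Proof.
have [su /compact_suppP[M uM]] := testfunP u; rewrite unfold_in inE.
split; first exact: smooth_cderivn.
by apply/compact_suppP; exists M; exact: cderivn_eq0.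
Qed.
Definition deriv_test j u : testfun R := Testfun (deriv_test_subproof j u).

Lemma shift_test_subproof h u : (fun y => u (y + h)) \in @in_test R.
Proof.
have [su /compact_suppP[M uM]] := testfunP u; rewrite unfold_in inE.
split.
  have -> : (fun y => u (y + h)) = (fun y => u (1 * y + h)).
    by apply/funext => y; rewrite mul1r.
  exact: smooth_affine.
apply/compact_suppP; exists (M + `|h|) => x Mx; apply: uM.
by rewrite -[h]opprK (lt_le_trans _ (lerB_dist _ _))// normrN ltrBrDr.
Qed.
Definition shift_test h u : testfun R := Testfun (shift_test_subproof h u).

Lemma reflect_test_subproof x u : (fun y => u (x - y)) \in @in_test R.
Proof.
have [su /compact_suppP[M uM]] := testfunP u; rewrite unfold_in inE.
split.
  have -> : (fun y => u (x - y)) = (fun y => u (-1 * y + x)).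
    by apply/funext => y; rewrite mulN1r addrC.
  exact: smooth_affine.
apply/compact_suppP; exists (M + `|x|) => y My; apply: uM.
by rewrite distrC (lt_le_trans _ (lerB_dist _ _))// ltrBrDr.
Qed.
Definition reflect_test x u : testfun R := Testfun (reflect_test_subproof x u).

Lemma test_DL1_subproof u : (u : R -> R[i]) \in @in_DL1 R.
Proof.
rewrite unfold_in inE; split=> [|i]; first by have [] := testfunP u.
have [_ ci] := testfunP (deriv_test i u).
by apply: compact_supp_L1norm => //; apply: smooth_continuous;
  have [] := testfunP u.
Qed.
Definition test_DL1 u : DL1 R := MkDL1 (test_DL1_subproof u).

End test_function_operations.

Section distributions.
Variable R : realType.
Implicit Types (T S : testfun R -> R[i]) (u : testfun R).

(* Continuity of [L] on [A] for the topology defined by the increasing sequence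
   of (semi)norms [p]. *)
Definition continuous_for (V : lmodType R[i]) (p : nat -> V -> \bar R)
    (A : set V) (L : V -> R[i]) :=
  forall v, A v -> forall e : R, 0 < e ->
  exists m, exists2 d : R, 0 < d &
    forall w, A w -> (p m (w - v)%R < d%:E)%E ->
      `|(L w - L v : Rcomplex R)| < e.

Definition test_norm (m : nat) (u : testfun R) : \bar R :=
  (\sum_(i < m.+1) supnorm (cderivn i u))%E.

Definition DL1_norm (m : nat) (u : DL1 R) : \bar R :=
  (\sum_(i < m.+1) L1norm (cderivn i u))%E.

(* The inductive limit topology on test functions: a linear form is continuous
   iff its restriction to the test functions supported in any given compact set
   is. *)
Definition is_distribution T : Prop :=
  scalar T /\ forall K : set R, compact K ->
    continuous_for test_norm [set u | supp u `<=` K] T.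

Definition DL1_dual (U : DL1 R -> R[i]) : Prop :=
  scalar U /\ continuous_for DL1_norm setT U.

(* The dual of [DL1 R], identified with a space of distributions by restriction
   to test functions. *)
Definition bounded_distribution T : Prop :=
  exists2 U : DL1 R -> R[i], DL1_dual U & T = U \o @test_DL1 R.

(* Only meaningful when [f] is locally integrable. *)
Definition regular (f : R -> R[i]) : testfun R -> R[i] :=
  fun u => cintegral (fun x => f x * u x).

Definition dderivn (j : nat) T : testfun R -> R[i] :=
  fun u => (-1) ^+ j * T (deriv_test j u).

Definition dshift (h : R) T : testfun R -> R[i] :=
  fun u => T (shift_test (- h) u).

Definition dconv T u : R -> R[i] := fun x => T (reflect_test x u).

(* Weak-* convergence; for sequences it coincides with convergence in the
   strong dual topology. *)
Definition dcvg (T_ : nat -> testfun R -> R[i]) S :=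
  forall u, (T_ k u : Rcomplex R) @[k --> \oo] --> (S u : Rcomplex R).

End distributions.

Section almost_automorphic.
Variable R : realType.

Definition subsequence (k : nat -> nat) := {homo k : m n / (m < n)%N}.

Definition almost_automorphic (f : R -> R[i]) : Prop :=
  continuous (f : R -> Rcomplex R) /\
  forall s : nat -> R, exists2 k, subsequence k &
  exists2 g : R -> R[i],
    forall x, (f (x + s (k n)) : Rcomplex R) @[n --> \oo] -->
              (g x : Rcomplex R) &
    forall x, (g (x - s (k n)) : Rcomplex R) @[n --> \oo] -->
              (f x : Rcomplex R).

End almost_automorphic.

(* Main.v *)
(* (1) => (2): almost automorphic functions are bounded, so one subsequence
   serves all the f_j and dominated convergence passes to the limit in the
   integrals against test functions.  (2) => (3): (T * u)(x + s_k) is the value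
   of tau_(s_k) T at the fixed test function u(x - .); the continuity of T * u
   comes from that of translations in D_(L^1).

   (3) => (1): the inverse of 1 + d/dx on D_(L^1) is w = resolvent v, with
   ||w||_1 <= 4 ||v||_1 and w' = v - w.  For a form V on D_(L^1),
   V(v) = V1(v) + V1(v') where V1 = V o resolvent has order one less than V, and
   V * phi is almost automorphic for all phi in D_(L^1) as soon as it is for all
   test functions (cut off, and pass to a uniform limit), a property that V1
   inherits.  After finitely many steps V has order 0.  Then, for a smooth step
   theta and theta_n(x) = theta((n + 1) x), the functions
   f_n(t) = V1(theta_n'(t - .)) are uniformly Cauchy, because the resolvent turns
   (theta_n - theta_m)' into something of L^1-norm O(1/n + 1/m); their uniform
   limit f is almost automorphic.  Finally V1(u) is the integral of f u: the
   function t |-> V1(theta_n(t - .) u) grows from 0 to V1(u), with derivative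
   V1(theta_n'(t - .) u), which is within O(1/n) of f(t) u(t). *)
Require Import Defs.
From HB Require Import structures.
From mathcomp Require Import all_boot all_order all_algebra.
From mathcomp Require Import complex.
From mathcomp Require Import all_classical all_reals all_analysis.
From mathcomp Require Import measurable_realfun ring lra.

Set Implicit Arguments.
Unset Strict Implicit.
Unset Printing Implicit Defensive.

Import Order.TTheory GRing.Theory Num.Theory.
Import numFieldNormedType.Exports.

Local Open Scope classical_set_scope.
Local Open Scope ring_scope.
Local Open Scope complex_scope.

(** * Complex-valued functions *)

(** With E(x) = e^(-x) for x > 0 and 0 elsewhere, the resolvent is v |-> E * v. A form V of order 0
    extends to L^1, where f(t) = V(E(. - t)) is the natural density of V1, almost automorphic
    because V meets only translates of one function. Forms live here on smooth functions and E jumps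
    at 0: theta_n'(t - .) approximates the Dirac mass at t, so its resolvent approximates E(. - t)
    in L^1. Duality with L^1 alone would give V a bounded measurable density; the last resolvent,
    applied at order 0, is spent on continuity. Exchanging V with an integral would call for
    vector-valued integration, hence the detour through a derivative in t. Unwinding the recursion
    gives T = (1 - d/dx)^(m+1) f for a form of order m: a single f supplies all the f_j. In the
    direction (1) => (2) the obstacle is that the limits of translates of the f_j need not be
    continuous, so integrals are set up for measurable functions. *)

Section complex_real_parts.
Variable R : realType.
Implicit Types (z w : Rcomplex R) (f g : R -> R[i]).

(* The norm [`|z|] of [R[i]] takes its values in [R[i]]; this one is real. *)
Definition cmod (z : R[i]) : R := `|z : Rcomplex R|.

Lemma ler_Re z : `|complex.Re z| <= cmod z.
Proof.
case: z => a b /=; rewrite /cmod /Num.norm/= -[leLHS]sqrtr_sqr.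
by rewrite ler_wsqrtr// lerDl sqr_ge0.
Qed.

Lemma ler_Im z : `|complex.Im z| <= cmod z.
Proof.
case: z => a b /=; rewrite /cmod /Num.norm/= -[leLHS]sqrtr_sqr.
by rewrite ler_wsqrtr// lerDr sqr_ge0.
Qed.

Lemma cmod_le z : cmod z <= `|complex.Re z| + `|complex.Im z|.
Proof.
case: z => a b /=; rewrite /cmod /Num.norm/=.
rewrite -(@ger0_norm _ (`|a| + `|b|)) ?addr_ge0// -(sqrtr_sqr (_ + _)).
rewrite ler_wsqrtr// sqrrD !real_normK ?num_real// lerD2r lerDl.
by rewrite mulrn_wge0// mulr_ge0.
Qed.

Lemma ReD z w : complex.Re (z + w) = complex.Re z + complex.Re w.
Proof. by case: z w => a b []. Qed.
Lemma ReN z : complex.Re (- z) = - complex.Re z.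
Proof. by case: z. Qed.
Lemma ImD z w : complex.Im (z + w) = complex.Im z + complex.Im w.
Proof. by case: z w => a b []. Qed.
Lemma ImN z : complex.Im (- z) = - complex.Im z.
Proof. by case: z. Qed.
Lemma complex_ext (a b : R[i]) :
  complex.Re a = complex.Re b -> complex.Im a = complex.Im b -> a = b.
Proof. by case: a b => a1 a2 [b1 b2] /= -> ->. Qed.

(** Copies of the projections and injections typed on the real normed module, so that R-linear
    instances can be attached to them and limits and derivatives transfer by continuous linear
    maps. *)
Definition cRe (z : Rcomplex R) : R := complex.Re z.
Definition cIm (z : Rcomplex R) : R := complex.Im z.
Definition of_Re (a : R) : Rcomplex R := a%:C.
Definition of_Im (a : R) : Rcomplex R := 0 +i* a.

Lemma cRe_is_linear : linear cRe.
Proof. by move=> k [a b] [c d]. Qed.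
HB.instance Definition _ :=
  GRing.isLinear.Build R (Rcomplex R) R _ cRe cRe_is_linear.
Lemma cIm_is_linear : linear cIm.
Proof. by move=> k [a b] [c d]. Qed.
HB.instance Definition _ :=
  GRing.isLinear.Build R (Rcomplex R) R _ cIm cIm_is_linear.
Lemma of_Re_is_linear : linear of_Re.
Proof. by move=> k a b; apply: complex_ext; rewrite /= ?mulr0 ?addr0. Qed.
HB.instance Definition _ :=
  GRing.isLinear.Build R R (Rcomplex R) _ of_Re of_Re_is_linear.
Lemma of_Im_is_linear : linear of_Im.
Proof. by move=> k a b; apply: complex_ext; rewrite /= ?mulr0 ?addr0. Qed.
HB.instance Definition _ :=
  GRing.isLinear.Build R R (Rcomplex R) _ of_Im of_Im_is_linear.

Lemma contraction_continuous (V W : normedModType R) (L : {linear V -> W}) :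
  (forall v, `|L v| <= `|v|) -> continuous L.
Proof.
move=> Lle; apply: bounded_linear_continuous; apply/linear_boundedP.
near=> r => v; rewrite (le_trans (Lle v))// ler_peMl//.
Unshelve. all: by end_near. Qed.

Lemma cRe_continuous : continuous cRe.
Proof. exact: (@contraction_continuous _ _ cRe ler_Re). Qed.

Lemma cIm_continuous : continuous cIm.
Proof. exact: (@contraction_continuous _ _ cIm ler_Im). Qed.

Lemma of_Re_continuous : continuous of_Re.
Proof.
apply: (@contraction_continuous _ _ of_Re) => a.
by have := cmod_le (of_Re a); rewrite /= normr0 addr0.
Qed.

Lemma of_Im_continuous : continuous of_Im.
Proof.
apply: (@contraction_continuous _ _ of_Im) => a.
by have := cmod_le (of_Im a); rewrite /= normr0 add0r.
Qed.

Lemma Re_Im_split z : z = of_Re (cRe z) + of_Im (cIm z).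
Proof. by case: z => a b; apply: complex_ext; rewrite /= ?addr0 ?add0r. Qed.

Lemma ccvgP (T : Type) (F : set_system T) (FF : Filter F) (h : T ->
  Rcomplex R) z :
  h @ F --> z <->
  (cRe (h x) @[x --> F] --> cRe z /\ cIm (h x) @[x --> F] --> cIm z).
Proof.
split=> [hz|[h1 h2]].
  split; [exact: (cvg_comp _ _ hz (cRe_continuous (x:=z)))
         |exact: (cvg_comp _ _ hz (cIm_continuous (x:=z)))].
have -> : h = (fun x => of_Re (cRe (h x)) + of_Im (cIm (h x))).
  by apply/funext => x; exact: Re_Im_split.
rewrite [z in _ --> z]Re_Im_split; apply: cvgD.
  exact: (cvg_comp _ _ h1 (of_Re_continuous (x:=_))).
exact: (cvg_comp _ _ h2 (of_Im_continuous (x:=_))).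
Qed.

Lemma ccontinuousP f : continuous (f : R -> Rcomplex R) <->
  (continuous (fun x => complex.Re (f x)) /\
   continuous (fun x => complex.Im (f x))).
Proof.
split=> [cf|[c1 c2] x]; last first.
  by apply/ccvgP; split; [exact: c1|exact: c2].
by split=> x; have /ccvgP[] := cf x.
Qed.

Lemma cis_derivP f x l :
  (derivable (f : R -> Rcomplex R) x 1 /\ cderivn 1 f x = l) <->
  (is_derive x 1 (fun y => complex.Re (f y)) (complex.Re l) /\
   is_derive x 1 (fun y => complex.Im (f y)) (complex.Im l)).
Proof.
have D1 h : derivable (h : R -> Rcomplex R) x 1 <->
    is_derive x 1 (h : R -> Rcomplex R) ((cderivn 1 h x : Rcomplex R)).
  split=> [dh|[//]]; rewrite /cderivn /= derive1E; exact: DeriveDef.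
(* Continuous linear maps commute with differentiation: the two projections give one direction, the
   two injections rebuild [f] in the other. *)
have comp (V W : normedModType R) (L : {linear V -> W}) (cL : continuous L)
    (h : R -> V) (d : V) : is_derive x 1 h d -> is_derive x 1 (L \o h) (L d).
  move=> [/derivable1_diffP dh <-].
  have dL : differentiable L (h x) by exact: linear_differentiable.
  apply: DeriveDef; first exact/derivable1_diffP/differentiable_comp.
  rewrite deriveE; last exact: differentiable_comp.
  by rewrite diff_comp//= diff_lin// deriveE.
split=> [[/D1 df <-]|[d1 d2]].
  split; [exact: (comp _ _ cRe cRe_continuous _ _ df)
         |exact: (comp _ _ cIm cIm_continuous _ _ df)].
have df : is_derive x 1 (f : R -> Rcomplex R) (l : Rcomplex R).
  have e1 := comp _ _ of_Re of_Re_continuous _ _ d1.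
  have e2 := comp _ _ of_Im of_Im_continuous _ _ d2.
  rewrite [l]Re_Im_split.
  have -> : (f : R -> Rcomplex R) = (of_Re \o (fun y => complex.Re (f y)))
     + (of_Im \o (fun y => complex.Im (f y))).
    by apply/funext => y; rewrite [LHS]Re_Im_split.
  exact: is_deriveD.
split; first by case: df.
by rewrite /cderivn /= derive1E; case: df.
Qed.

End complex_real_parts.

(** * Differentiation rules and criteria for smoothness *)

Section complex_derivative.
Variable R : realType.
Implicit Types (f g v w : R -> R[i]).

Definition is_cderive f x (l : R[i]) :=
  derivable (f : R -> Rcomplex R) x 1 /\ cderivn 1 f x = l.

Lemma smooth_is_cderive f n x : smooth f ->
  is_cderive (cderivn n f) x (cderivn n.+1 f x).
Proof. by move=> sf; split => //; exact: sf. Qed.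

Lemma smooth_continuousW f : smooth f -> continuous (f : R -> Rcomplex R).
Proof. by move=> sf; exact: (@smooth_continuous _ f 0). Qed.

Lemma cderivn1E f g : (forall x, is_cderive f x (g x)) -> cderivn 1 f = g.
Proof. by move=> fg; apply/funext => x; case: (fg x). Qed.

Lemma is_cderive_cst (a : R[i]) x : is_cderive (fun=> a) x 0.
Proof. by apply/cis_derivP; split; exact: is_derive_cst. Qed.

Lemma is_cderiveD f g x a b : is_cderive f x a -> is_cderive g x b ->
  is_cderive (f + g) x (a + b).
Proof.
move=> /cis_derivP[f1 f2] /cis_derivP[g1 g2]; apply/cis_derivP; split.
  have -> : (fun y => complex.Re ((f + g) y)) =
    (fun y => complex.Re (f y)) + (fun y => complex.Re (g y)).
    by apply/funext => y; rewrite ReD.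
  by rewrite ReD; exact: is_deriveD.
have -> : (fun y => complex.Im ((f + g) y)) =
  (fun y => complex.Im (f y)) + (fun y => complex.Im (g y)).
  by apply/funext => y; rewrite ImD.
by rewrite ImD; exact: is_deriveD.
Qed.

Lemma is_cderiveN f x a : is_cderive f x a -> is_cderive (- f) x (- a).
Proof.
move=> /cis_derivP[f1 f2]; apply/cis_derivP; split.
  have -> : (fun y => complex.Re ((- f) y)) = - (fun y => complex.Re (f y)).
    by apply/funext => y; rewrite ReN.
  by rewrite ReN; exact: is_deriveN.
have -> : (fun y => complex.Im ((- f) y)) = - (fun y => complex.Im (f y)).
  by apply/funext => y; rewrite ImN.
by rewrite ImN; exact: is_deriveN.
Qed.

Lemma is_cderiveB f g x a b : is_cderive f x a -> is_cderive g x b ->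
  is_cderive (f - g) x (a - b).
Proof. by move=> fa gb; exact/is_cderiveD/is_cderiveN. Qed.

Lemma is_cderiveM f g x a b : is_cderive f x a -> is_cderive g x b ->
  is_cderive (f \* g) x (a * g x + f x * b).
Proof.
move=> /cis_derivP[f1 f2] /cis_derivP[g1 g2]; apply/cis_derivP.
have Re_mul (z w : R[i]) : complex.Re (z * w) =
  complex.Re z * complex.Re w - complex.Im z * complex.Im w.
  by case: z w => ? ? [].
have Im_mul (z w : R[i]) : complex.Im (z * w) =
  complex.Re z * complex.Im w + complex.Im z * complex.Re w.
  by case: z w => ? ? [].
split.
  have -> : (fun y => complex.Re ((f \* g) y)) =
    (fun y => complex.Re (f y)) * (fun y => complex.Re (g y)) -
    (fun y => complex.Im (f y)) * (fun y => complex.Im (g y)).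
    by apply/funext => y; rewrite /= Re_mul.
  apply: is_derive_eq (is_deriveB (is_deriveM f1 g1) (is_deriveM f2 g2)) _.
  by rewrite ReD !Re_mul /GRing.scale/=; ring.
have -> : (fun y => complex.Im ((f \* g) y)) =
  (fun y => complex.Re (f y)) * (fun y => complex.Im (g y)) +
  (fun y => complex.Im (f y)) * (fun y => complex.Re (g y)).
  by apply/funext => y; rewrite /= Im_mul.
apply: is_derive_eq (is_deriveD (is_deriveM f1 g2) (is_deriveM f2 g1)) _.
by rewrite ImD !Im_mul /GRing.scale/=; ring.
Qed.

Lemma is_cderive_real (h : R -> R) (x d : R) : is_derive x 1 h d ->
  is_cderive (fun y => (h y)%:C) x d%:C.
Proof. by move=> hd; apply/cis_derivP; split => //; exact: is_derive_cst. Qed.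

(** Smoothness by a class stable under derivation, for functions whose iterated derivatives have no
    convenient closed form. *)
Lemma smooth_coind (P : (R -> R[i]) -> Prop) :
  (forall f x, P f -> derivable (f : R -> Rcomplex R) x 1) ->
  (forall f, P f -> P (cderivn 1 f)) -> forall f, P f -> smooth f.
Proof.
move=> Pd PD f Pf n; elim: n f Pf => [f Pf x|n IH f Pf x]; first exact: Pd.
by rewrite -addn1 -cderivnD; exact/IH/PD.
Qed.

(* Closed under differentiation, which yields the smoothness of products. *)
Inductive leibniz_sum : (R -> R[i]) -> Prop :=
| leibniz_mul f g : smooth f -> smooth g -> leibniz_sum (f \* g)
| leibniz_add f g : leibniz_sum f -> leibniz_sum g -> leibniz_sum (f + g).

Lemma smoothM f g : smooth f -> smooth g -> smooth (f \* g).
Proof.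
have D h : leibniz_sum h -> exists2 h', leibniz_sum h' &
    forall x, is_cderive h x (h' x).
  elim=> {h} [h k sh sk|h k _ [h' lh' hh'] _ [k' lk' kk']].
    exists (cderivn 1 h \* k + h \* cderivn 1 k).
      by apply: leibniz_add; apply: leibniz_mul => //; exact: smooth_cderivn.
    by move=> x; apply: is_cderiveM; exact: (@smooth_is_cderive _ 0).
  exists (h' + k'); first exact: leibniz_add.
  by move=> x; exact: is_cderiveD.
move=> sf sg; apply: (smooth_coind (P := leibniz_sum)).
- by move=> h x /D[h' _ /(_ x)[]].
- by move=> h /D[h' lh' /cderivn1E ->].
- exact: leibniz_mul.
Qed.

Lemma cderivnM1 f g : smooth f -> smooth g ->
  cderivn 1 (f \* g) = cderivn 1 f \* g + f \* cderivn 1 g.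
Proof.
move=> sf sg; apply: cderivn1E => x.
by apply: is_cderiveM; exact: (@smooth_is_cderive _ 0).
Qed.

Lemma cderivn_add n f g : smooth f -> smooth g ->
  cderivn n (f + g) = cderivn n f + cderivn n g.
Proof. by move=> sf sg; rewrite -[f]scale1r cderivn_lin// !scale1r. Qed.

Lemma smoothZ (a : R[i]) f : smooth f -> smooth (a *: f).
Proof. by move=> sf; rewrite -[X in smooth X]addr0; apply: smooth_lin => //;
  exact: smooth0. Qed.

Lemma cderivnZ n (a : R[i]) f : smooth f ->
  cderivn n (a *: f) = a *: cderivn n f.
Proof.
move=> sf; rewrite -[X in cderivn n X]addr0 cderivn_lin//; last exact: smooth0.
by rewrite cderivn0 addr0.
Qed.

Lemma smoothB f g : smooth f -> smooth g -> smooth (f - g).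
Proof. move=> sf sg; have -> : f - g = (-1) *: g + f by rewrite scaleN1r addrC.
exact: smooth_lin. Qed.

Lemma cderivn_sub n f g : smooth f -> smooth g ->
  cderivn n (f - g) = cderivn n f - cderivn n g.
Proof.
move=> sf sg; have E (u v : R -> R[i]) : u - v = (-1) *: v + u.
  by rewrite scaleN1r addrC.
by rewrite !E cderivn_lin.
Qed.

Lemma smooth_cst (a : R[i]) : smooth (fun=> a).
Proof.
apply: (smooth_coind (P := fun f => exists b : R[i], f = fun=> b)).
- by move=> _ x [b ->]; case: (is_cderive_cst b x).
- by move=> _ [b ->]; exists 0; exact/cderivn1E/is_cderive_cst.
- by exists a.
Qed.

(** The companion criterion when the candidate derivatives are known by a recursion. *)
Lemma smooth_seq (F : nat -> R -> R[i]) :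
  (forall n x, is_cderive (F n) x (F n.+1 x)) ->
  smooth (F 0) /\ forall n, cderivn n (F 0) = F n.
Proof.
move=> FF; have E n : cderivn n (F 0) = F n.
  by elim: n => // n IH; rewrite cderivnS IH; exact: cderivn1E.
by split=> // n x; rewrite E; case: (FF n x).
Qed.

(** The equation bootstraps: each derivative of [w] is expressed by one of [v] and the previous one
    of [w], so one derivative of [w] yields all of them. *)
Lemma smooth_ode v w : smooth v -> (forall x, is_cderive w x (v x - w x)) ->
  smooth w /\ forall n, cderivn n.+1 w = cderivn n v - cderivn n w.
Proof.
move=> sv wv; pose F := fix F n :=
  if n is n'.+1 then cderivn n' v - F n' else w.
have [sw E] : smooth (F 0) /\ forall n, cderivn n (F 0) = F n.
  apply: smooth_seq; elim=> [|n IH] x; first exact: wv.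
  by apply: is_cderiveB; [exact: smooth_is_cderive|exact: IH].
by split=> // n; rewrite (E n.+1) (E n).
Qed.

End complex_derivative.

(** * Integrals of complex-valued functions *)
Section complex_integral.
Variable R : realType.
Notation mu := (@lebesgue_measure R).
Implicit Types (f g h : R -> R[i]).

(** Measurability rather than continuity, because the pointwise limits of translates of an almost
    automorphic function can be discontinuous. *)
Definition cmeasurable f :=
  measurable_fun [set: R] (fun x => complex.Re (f x)) /\
  measurable_fun [set: R] (fun x => complex.Im (f x)).

Definition cintegrable f :=
  mu.-integrable [set: R] (EFin \o (fun x => complex.Re (f x))) /\
  mu.-integrable [set: R] (EFin \o (fun x => complex.Im (f x))).

Lemma continuous_cmeasurable f :
  continuous (f : R -> Rcomplex R) -> cmeasurable f.
Proof. by case/ccontinuousP; split; exact: continuous_measurable_fun. Qed.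

Lemma cmeasurableM f g : cmeasurable f -> cmeasurable g ->
  cmeasurable (fun x => f x * g x).
Proof.
move=> [f1 f2] [g1 g2]; split.
  have -> : (fun x => complex.Re (f x * g x)) =
      (fun x => complex.Re (f x)) \* (fun x => complex.Re (g x)) \-
      (fun x => complex.Im (f x)) \* (fun x => complex.Im (g x)).
    by apply/funext => x /=; case: (f x) (g x) => ? ? [].
  by apply: measurable_funB; exact: measurable_funM.
have -> : (fun x => complex.Im (f x * g x)) =
    (fun x => complex.Re (f x)) \* (fun x => complex.Im (g x)) \+
    (fun x => complex.Im (f x)) \* (fun x => complex.Re (g x)).
  by apply/funext => x /=; case: (f x) (g x) => ? ? [].
by apply: measurable_funD; exact: measurable_funM.
Qed.

Lemma cmeasurable_cvg (f_ : nat -> R ->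
  R[i]) f : (forall n, cmeasurable (f_ n)) ->
  (forall x, (f_ n x : Rcomplex R) @[n --> \oo] --> (f x : Rcomplex R)) ->
  cmeasurable f.
Proof.
move=> mf ff; split.
- apply: (measurable_fun_cvg (h := fun n x => complex.Re (f_ n x))).
    by move=> n; case: (mf n).
  by move=> x _; have /ccvgP[] := ff x.
- apply: (measurable_fun_cvg (h := fun n x => complex.Im (f_ n x))).
    by move=> n; case: (mf n).
  by move=> x _; have /ccvgP[] := ff x.
Qed.

(** The factor 2 comes from bounding the real and the imaginary parts separately by [k]; no sharp
    constant is sought. *)
Lemma cintegrable_dom f (k : R -> R) : cmeasurable f ->
  mu.-integrable [set: R] (EFin \o k) -> (forall x, cmod (f x) <= k x) ->
  cintegrable f /\ cmod (cintegral f) <= \int[mu]_x k x *+ 2.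
Proof.
move=> [m1 m2] ik fk.
have k0 x : 0 <= k x by rewrite (le_trans _ (fk x))// normr_ge0.
have i1 : mu.-integrable [set: R] (EFin \o (fun x => complex.Re (f x))).
  apply: le_integrable ik => //; first exact/measurable_EFinP.
  by move=> x _; rewrite /= lee_fin (ger0_norm (k0 _)) (le_trans (ler_Re _)).
have i2 : mu.-integrable [set: R] (EFin \o (fun x => complex.Im (f x))).
  apply: le_integrable ik => //; first exact/measurable_EFinP.
  by move=> x _; rewrite /= lee_fin (ger0_norm (k0 _)) (le_trans (ler_Im _)).
split=> //; apply: (le_trans (cmod_le _)); rewrite mulr2n /=.
apply: lerD; apply: (le_trans (le_normr_Rintegral _ _)) => //.
  apply: le_Rintegral => //; first exact: integrable_norm.
  by move=> x _; rewrite (le_trans (ler_Re _)).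
apply: le_Rintegral => //; first exact: integrable_norm.
by move=> x _; rewrite (le_trans (ler_Im _)).
Qed.

Lemma integrableRD (k l : R -> R) : mu.-integrable [set: R] (EFin \o k) ->
  mu.-integrable [set: R] (EFin \o l) ->
  mu.-integrable [set: R] (EFin \o (fun x => k x + l x)).
Proof. exact: integrableD. Qed.

Lemma integrableRB (k l : R -> R) : mu.-integrable [set: R] (EFin \o k) ->
  mu.-integrable [set: R] (EFin \o l) ->
  mu.-integrable [set: R] (EFin \o (fun x => k x - l x)).
Proof. exact: integrableB. Qed.

Lemma integrableRZ (r : R) (k : R -> R) : mu.-integrable [set: R] (EFin \o k) ->
  mu.-integrable [set: R] (EFin \o (fun x => r * k x)).
Proof. exact: integrableZl. Qed.

Lemma cintegral_lin (a : R[i]) f g : cintegrable f -> cintegrable g ->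
  cintegral (fun x => a * f x + g x) = a * cintegral f + cintegral g.
Proof.
case: a => a b [f1 f2] [g1 g2].
apply: complex_ext.
  rewrite /cintegral/=.
  under eq_Rintegral.
    move=> x _; rewrite (_ : complex.Re _ = a * complex.Re (f x) -
      b * complex.Im (f x) + complex.Re (g x)); last first.
      by case: (f x) (g x) => ? ? [].
    over.
  rewrite RintegralD//; last by apply: integrableRB; exact: integrableRZ.
  by rewrite RintegralB ?RintegralZl//; exact: integrableRZ.
rewrite /cintegral/=.
under eq_Rintegral.
  move=> x _; rewrite (_ : complex.Im _ = a * complex.Im (f x) +
    b * complex.Re (f x) + complex.Im (g x)); last first.
    by case: (f x) (g x) => ? ? [].
  over.
rewrite RintegralD//; last by apply: integrableRD; exact: integrableRZ.
by rewrite RintegralD ?RintegralZl//; exact: integrableRZ.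
Qed.

Lemma Rintegral_dct (F_ : nat -> R -> R) (F k : R -> R) :
  (forall n, measurable_fun [set: R] (F_ n)) ->
  (forall x, F_ n x @[n --> \oo] --> F x) ->
  mu.-integrable [set: R] (EFin \o k) -> (forall n x, `|F_ n x| <= k x) ->
  \int[mu]_x F_ n x @[n --> \oo] --> \int[mu]_x F x.
Proof.
move=> mF_ FF ik Fk.
have mF : measurable_fun [set: R] F.
  by apply: (measurable_fun_cvg (h := F_)) => // x _; exact: FF.
have [|||||iF _ cF] := @dominated_convergence _ _ _ mu _ measurableT
  (fun n => EFin \o F_ n) (EFin \o F) (EFin \o k).
- by move=> n; apply/measurable_EFinP; exact: mF_.
- exact/measurable_EFinP.
- by apply: aeW => x _; apply: cvg_EFin; [exact: nearW|exact: FF].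
- by [].
- by apply: aeW => x n _; rewrite lee_fin.
apply: fine_cvg; rewrite fineK; first exact: cF.
exact: integrable_fin_num.
Qed.

Lemma cintegral_dct (f_ : nat -> R -> R[i]) f (k : R -> R) :
  (forall n, cmeasurable (f_ n)) ->
  (forall x, (f_ n x : Rcomplex R) @[n --> \oo] --> (f x : Rcomplex R)) ->
  mu.-integrable [set: R] (EFin \o k) -> (forall n x, cmod (f_ n x) <= k x) ->
  (cintegral (f_ n) : Rcomplex R) @[n --> \oo] --> (cintegral f : Rcomplex R).
Proof.
move=> mf ff ik fk.
apply/ccvgP; split; apply: (Rintegral_dct _ _ ik) => //.
- by move=> n; case: (mf n).
- by move=> x; have /ccvgP[] := ff x.
- by move=> n x; exact: le_trans (ler_Re _) (fk n x).
- by move=> n; case: (mf n).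
- by move=> x; have /ccvgP[] := ff x.
- by move=> n x; exact: le_trans (ler_Im _) (fk n x).
Qed.

(** The image of Lebesgue measure under [phi] agrees with it on half-open intervals, hence
    everywhere. Translations and reflections are both instances. *)
Lemma ge0_integral_invariant (phi : R -> R) (k : R -> \bar R) :
  measurable_fun [set: R] phi ->
  (forall a b, a < b -> mu (phi @^-1` `]a, b]) = (b - a)%:E) ->
  measurable_fun [set: R] k -> (forall x, 0 <= k x)%E ->
  (\int[mu]_x k (phi x) = \int[mu]_x k x)%E.
Proof.
move=> mphi muphi mk k0.
pose f : measurableTypeR R -> measurableTypeR R := phi.
have mf : measurable_fun [set: measurableTypeR R] f by exact: mphi.
transitivity (\int[pushforward mu f]_x k x)%E.
  by rewrite (@ge0_integral_pushforward _ _ _ _ _ _ mf).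
apply: eq_measure_integral => A mA _; apply/esym.
apply: lebesgue_measure_unique => //.
move=> X /ocitvP[->|[[a b] /= ab ->]]; first by rewrite !measure0.
by rewrite /pushforward /f muphi// lebesgue_measure_itv/= lte_fin ab -EFinB.
Qed.

Lemma integral_invariant (phi : R -> R) (k : R -> \bar R) :
  measurable_fun [set: R] phi ->
  (forall a b, a < b -> mu (phi @^-1` `]a, b]) = (b - a)%:E) ->
  measurable_fun [set: R] k ->
  (\int[mu]_x k (phi x) = \int[mu]_x k x)%E.
Proof.
move=> mphi muphi mk; rewrite integralE [RHS]integralE.
congr (_ - _)%E.
  have := ge0_integral_invariant mphi muphi (measurable_funepos mk).
  move=> <-; last by move=> x; exact: funepos_ge0.
  by apply: eq_integral => x _; rewrite ?funeposE.
have := ge0_integral_invariant mphi muphi (measurable_funeneg mk).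
  move=> <-; last by move=> x; exact: funeneg_ge0.
  by apply: eq_integral => x _; rewrite ?funenegE.
Qed.

Lemma measurable_shift (c : R) : measurable_fun [set: R] (fun x : R => x + c).
Proof. exact: measurable_funD. Qed.

Lemma measurable_reflect (c : R) : measurable_fun [set: R] (fun x : R => c - x).
Proof. exact: measurable_funB. Qed.

Lemma lebesgue_shift (c a b : R) : a < b ->
  mu ((fun x : R => x + c) @^-1` `]a, b]) = (b - a)%:E.
Proof.
move=> ab; rewrite (_ : _ @^-1` _ = `]a - c, b - c]%classic); last first.
  by apply/seteqP; split=> x /=; rewrite !in_itv/= ltrBlDr lerBrDr.
rewrite lebesgue_measure_itv/= lte_fin ltrD2r ab -EFinB; congr EFin; ring.
Qed.

Lemma lebesgue_reflect (c a b : R) : a < b ->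
  mu ((fun x : R => c - x) @^-1` `]a, b]) = (b - a)%:E.
Proof.
move=> ab; rewrite (_ : _ @^-1` _ = `[c - b, c - a[%classic); last first.
  apply/seteqP; split=> x /=; rewrite !in_itv/= => /andP[]; lra.
rewrite lebesgue_measure_itv/= lte_fin ltrD2l ltrN2 ab.
by rewrite -EFinB; congr EFin; ring.
Qed.

Lemma cintegral_shift (c : R) f : cmeasurable f ->
  cintegral (fun x => f (x + c)) = cintegral f.
Proof.
move=> [m1 m2]; have I := integral_invariant (measurable_shift c)
  (lebesgue_shift c).
by congr (_ +i* _); congr fine; apply: I; exact/measurable_EFinP.
Qed.

Lemma L1norm_reflect (c : R) f : continuous (f : R -> Rcomplex R) ->
  L1norm (fun x => f (c - x)) = L1norm f.
Proof.
move=> cf; apply: (ge0_integral_invariant (measurable_reflect c)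
  (lebesgue_reflect c)).
  exact: cabs_measurable.
by move=> x; rewrite lee_fin cabs_ge0.
Qed.

(** Real-valued, to allow arithmetic on norms; it is the L^1 norm only when that is finite, an
    infinite integral being sent to 0. *)
Definition l1 f : R := \int[mu]_x cabs f x.

Definition cL1 f := continuous (f : R -> Rcomplex R) /\ (L1norm f < +oo)%E.

Lemma cL1_integrable f : cL1 f -> mu.-integrable [set: R] (EFin \o cabs f).
Proof.
move=> [cf f1]; apply/integrableP; split; first exact: cabs_measurable.
by under eq_integral do rewrite /= ger0_norm ?cabs_ge0//.
Qed.

Lemma L1normE f : cL1 f -> L1norm f = (l1 f)%:E.
Proof.
move=> f1; rewrite /l1 /Rintegral fineK//.
by apply: integrable_fin_num => //; exact: cL1_integrable.
Qed.

Lemma l1_ge0 f : 0 <= l1 f.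
Proof. by apply: Rintegral_ge0 => x _; exact: cabs_ge0. Qed.

Lemma cL1_dom f (k : R -> R) : continuous (f : R -> Rcomplex R) ->
  mu.-integrable [set: R] (EFin \o k) -> (forall x, cmod (f x) <= k x) ->
  cL1 f /\ l1 f <= \int[mu]_x k x.
Proof.
move=> cf ik fk; have k0 x : 0 <= k x by rewrite (le_trans _
  (fk x))// normr_ge0.
have f1 : cL1 f.
  split=> //; have /integrableP[_] := ik; apply: le_lt_trans.
  apply: ge0_le_integral => //=.
  - by move=> x _; rewrite lee_fin cabs_ge0.
  - exact: cabs_measurable.
  - by have /integrableP[mk _] := integrable_norm ik.
  - by move=> x _; rewrite lee_fin ger0_norm//; exact: fk.
split=> //; apply: le_Rintegral => //; first exact: cL1_integrable.
by move=> x _; exact: fk.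
Qed.

Lemma cL1_lin (a : R[i]) f g : cL1 f -> cL1 g -> cL1 (a *: f + g).
Proof.
move=> [cf f1] [cg g1]; split; last exact: L1norm_lin_lty.
move=> x; apply: (@continuousD _ _ _
    (Rcomplex_mull (a : Rcomplex R) \o (f : R -> Rcomplex R)) g) => //.
- exact: continuous_comp (cf x) (@Rcomplex_mull_continuous _ _ _).
- exact: cg.
Qed.

Lemma cL10 : cL1 0.
Proof. by split; [move=> x; exact: cvg_cst|rewrite L1norm0]. Qed.

Lemma cmodM (a b : R[i]) : cmod (a * b) = cmod a * cmod b.
Proof. exact: (@Rcomplex_normrM R). Qed.

Lemma l1_lin (a : R[i]) f g : cL1 f -> cL1 g ->
  l1 (a *: f + g) <= cmod a * l1 f + l1 g.
Proof.
move=> f1 g1; rewrite /l1 -RintegralZl//; last exact: cL1_integrable.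
rewrite -RintegralD//; last exact: cL1_integrable.
  apply: le_Rintegral => //.
  - exact/cL1_integrable/cL1_lin.
  - by apply: integrableRD; [apply: integrableRZ|]; exact: cL1_integrable.
  - move=> x _; rewrite -cmodM; exact: (@ler_normD _ (Rcomplex R)).
by apply: integrableRZ; exact: cL1_integrable.
Qed.

Lemma l1_reflect (c : R) f : continuous (f : R -> Rcomplex R) ->
  l1 (fun x => f (c - x)) = l1 f.
Proof. by move=> cf; congr fine; exact: L1norm_reflect. Qed.

End complex_integral.

(** * A smooth step function *)
Section smooth_step.
Variable R : realType.
Implicit Types (f : R -> R) (p : {poly R}).

(** Differentiability from a quadratic remainder, for the places where no differentiation rule
    applies: the gluing point of the flat functions, and functions of t defined through an abstract
    linear form. *)
Lemma is_derive_quadratic f x d C :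
  (forall h, `|h| < 1 -> `|f (x + h) - f x - h * d| <= C * h ^+ 2) ->
  is_derive x 1 f d.
Proof.
move=> fC; have C0 : 0 <= C.
  have := fC 2^-1; rewrite ger0_norm ?invr_ge0// => /(_ _)/(le_trans
    (normr_ge0 _)).
  by rewrite pmulr_lge0 ?exprn_gt0 ?invr_gt0//; apply; rewrite invf_lt1// ltr1n.
have cv : h^-1 *: (f (h *: (1 : R) + x) - f x) @[h --> (0 : R)^'] --> d.
  apply/cvgrPdist_le => e e0; near=> h.
  have h0 : h != 0 by near: h; exact: nbhs_dnbhs_neq.
  have h1 : `|h| < 1 by near: h; apply: dnbhs0_lt.
  have hc : `|h| <= e / (C + 1).
    by near: h; apply: dnbhs0_le; rewrite divr_gt0// ltr_wpDl.
  rewrite distrC -(ler_pM2l (_ : 0 < `|h|)) ?normr_gt0// -normrM mulrBr.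
  rewrite /GRing.scale/= mulrA divff// mul1r mulr1 [h + x]addrC.
  apply: (le_trans (fC h h1)); rewrite -(ger0_norm
    (sqr_ge0 h)) expr2 normrM mulrCA.
  rewrite ler_wpM2l// (@le_trans _ _ ((C + 1) * `|h|))//.
    by rewrite ler_wpM2r// lerDl.
  by rewrite mulrC -ler_pdivlMr// ltr_wpDl.
apply: DeriveDef; first by apply/cvg_ex; exists d.
exact: (cvg_lim (@Rhausdorff R)).
Unshelve. all: by end_near. Qed.

(** Termwise, y^i <= i! e^y by the exponential series; hence the factorials in the constant. *)
Lemma exp_dominates_poly p : exists C, forall y, 0 <= y ->
  `|p.[y]| <= C * expR y.
Proof.
exists (\sum_(i < size p) `|p`_i| * i`!%:R) => y y0.
rewrite horner_coef mulr_suml (le_trans (ler_norm_sum _ _ _))//.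
apply: ler_sum => i _; rewrite normrM -mulrA ler_wpM2l// normrX (ger0_norm y0).
rewrite -ler_pdivrMl ?ltr0n ?fact_gt0// mulrC.
case: (i : nat) => [|n]; last by rewrite (le_trans _
  (expR_ge1Dxn n y0))// lerDr.
by rewrite expr0 fact0 divr1 (le_trans _ (expR_ge1Dx y))// lerDl.
Qed.

(* The functions [p(1/x) e^(-1/x)] extended by [0] to the left: the derivative
   of the one attached to [p] is attached to [X^2 (p - p')]. *)
Definition flat_fun p (x : R) : R :=
  if 0 < x then p.[x^-1] * expR (- x^-1) else 0.

Lemma is_derive_flat_fun p (x : R) :
  is_derive x 1 (flat_fun p) (flat_fun ('X^2 * (p - p^`())) x).
Proof.
rewrite {2}/flat_fun; have [x0|x0|x0] := ltgtP 0 x.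
- apply: (@near_eq_is_derive _ R R (fun y : R => p.[y^-1] * expR (- y^-1))).
    near=> y; rewrite /flat_fun ifT//.
    by near: y; exact: lt_nbhsr.
  have dV : is_derive x 1 (fun y : R => y^-1) (- x ^- 2).
    have := @is_deriveV R id x 1 1 (lt0r_neq0 x0) (is_derive_id _ _).
    by rewrite /GRing.scale/= mulr1.
  have dp := is_derive1_comp (is_derive_poly p x^-1) dV.
  have de := @is_derive1_comp _ expR (fun y : R => - y^-1) x _ _
    (is_derive_expR _) (is_deriveN dV).
  apply: is_derive_eq (is_deriveM dp de) _.
  rewrite /GRing.scale/= hornerM hornerXn hornerD hornerN exprVn.
  move: (x ^- 2) (p.[x^-1]) (p^`().[x^-1]) (expR (- x^-1)) => a b c d.
  ring.
- apply: (@near_eq_is_derive _ R R (cst 0)).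
  near=> y; rewrite /flat_fun ifF//; apply/negbTE; rewrite -leNgt.
  by apply: ltW; near: y; exact: lt_nbhsl.
(* At the gluing point, the bound |y^2 p(y)| <= C e^y with y = 1/h reads |p(1/h) e^(-1/h)| <= C h^2,
   so the derivative is 0. *)
- rewrite -x0; have [C hC] := exp_dominates_poly ('X^2 * p).
  apply: (@is_derive_quadratic _ _ _ C) => h _.
  rewrite add0r mulr0 subr0 /flat_fun ltxx subr0.
  have C0 : 0 <= C.
    by have := le_trans (normr_ge0 _) (hC 0 (lexx _)); rewrite expR0 mulr1.
  case: ifPn => h0; last by rewrite normr0 mulr_ge0// sqr_ge0.
  have hV : 0 <= h^-1 by rewrite invr_ge0 ltW.
  have := hC _ hV; rewrite hornerM hornerXn normrM (ger0_norm (exprn_ge0 _ hV)).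
  rewrite exprVn normrM expRN (@ger0_norm _
    (expR _)^-1) ?invr_ge0 ?expR_ge0// => hCh.
  by rewrite ler_pdivrMr ?expR_gt0// mulrAC mulrC -ler_pdivrMl ?exprn_gt0//
    mulrC.
Unshelve. all: by end_near. Qed.

Lemma smooth_flat_fun p : smooth (fun x => (flat_fun p x)%:C).
Proof.
pose q := fix q n := if n is n'.+1 then 'X^2 * (q n' - (q n')^`()) else p.
have [] // := @smooth_seq R (fun n x => (flat_fun (q n) x)%:C).
by move=> n x; exact/is_cderive_real/is_derive_flat_fun.
Qed.

Definition bump_fun x : R := flat_fun 1 x * flat_fun 1 (1 - x).

Lemma flat_fun1_ge0 x : 0 <= flat_fun 1 x.
Proof. by rewrite /flat_fun; case: ifPn => // _;
  rewrite hornerC mul1r expR_ge0. Qed.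

Lemma flat_fun1_gt0 x : 0 < x -> 0 < flat_fun 1 x.
Proof. by rewrite /flat_fun => ->; rewrite hornerC mul1r expR_gt0. Qed.

Lemma bump_fun_ge0 x : 0 <= bump_fun x.
Proof. by rewrite mulr_ge0 ?flat_fun1_ge0. Qed.

Lemma bump_fun_gt0 x : 0 < x -> x < 1 -> 0 < bump_fun x.
Proof. by move=> x0 x1; rewrite mulr_gt0 ?flat_fun1_gt0 ?subr_gt0. Qed.

Lemma bump_fun_le0 x : x <= 0 -> bump_fun x = 0.
Proof. by move=> x0; rewrite /bump_fun /flat_fun ltNge x0 mul0r. Qed.

Lemma bump_fun_ge1 x : 1 <= x -> bump_fun x = 0.
Proof. by move=> x0; rewrite /bump_fun [X in _ * X]/flat_fun subr_gt0 ltNge x0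
  mulr0. Qed.

Lemma smooth_bump_fun : smooth (fun x => (bump_fun x)%:C).
Proof.
have -> : (fun x => (bump_fun x)%:C) = (fun x => (flat_fun 1 x)%:C) \*
    (fun x => (flat_fun 1 (-1 * x + 1))%:C).
  apply/funext => x; rewrite /= /bump_fun mulN1r [- x + 1]addrC.
  by apply: complex_ext; rewrite /= ?mulr0 ?mul0r ?subr0 ?addr0.
apply: smoothM; first exact: smooth_flat_fun.
exact: (smooth_affine (s := -1) (c := 1) (@smooth_flat_fun 1)).
Qed.

End smooth_step.

(** * The normalised primitive of the bump *)

Section smooth_step_construction.
Variable R : realType.
Notation mu := (@lebesgue_measure R).

Lemma Rintegral_indic_itv (a b : R) : a <= b ->
  \int[mu]_x \1_(`[a, b]%classic : set R) x = b - a.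
Proof.
move=> ab; have E : (\int[mu]_x (\1_(`[a, b]%classic : set R) x)%:E =
  mu `[a, b])%E.
  by rewrite integral_indic// setIT.
rewrite /Rintegral E lebesgue_measure_itv/= lte_fin.
by case: ltgtP ab => //= -> _; rewrite subrr.
Qed.

Lemma integrable_bump (k : R -> R) (a b c : R) : measurable_fun [set: R] k ->
  a <= b -> (forall x, `|k x| <= c) -> (forall x, x < a -> k x = 0) ->
  (forall x, b < x -> k x = 0) ->
  mu.-integrable [set: R] (EFin \o k) /\ \int[mu]_x `|k x| <= c * (b - a).
Proof.
move=> mk ab kc ka kb.
have c0 : 0 <= c := le_trans (normr_ge0 _) (kc 0).
pose h x := c * \1_(`[a, b]%classic : set R) x.
have ih : mu.-integrable [set: R] (EFin \o h).
  by apply: integrableRZ; exact: integrable_indic_itv.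
have kh x : `|k x| <= h x.
  rewrite /h indicE; have [xa|ax] := ltP x a.
    by rewrite ka// normr0 mulr_ge0.
  have [bx|xb] := ltP b x; first by rewrite kb// normr0 mulr_ge0.
  by rewrite mem_set ?mulr1//= in_itv/= ax xb.
have ik : mu.-integrable [set: R] (EFin \o k).
  apply: le_integrable ih => //; first exact/measurable_EFinP.
  by move=> x _; rewrite /= lee_fin (le_trans (kh x))// ler_norm.
split=> //; apply: (@le_trans _ _ (\int[mu]_x h x)).
  by apply: le_Rintegral => //; exact: integrable_norm.
rewrite /h RintegralZl ?Rintegral_indic_itv//.
exact: integrable_indic_itv.
Qed.

Lemma bounded_bump (k : R -> R) (M : R) : continuous k ->
  (forall x, M < `|x| -> k x = 0) -> exists C, forall x, `|k x| <= C.
Proof.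
move=> ck kM; wlog M0 : M kM / 0 <= M => [W|].
  have [/W|M0] := leP 0 M; first exact.
  by exists 0 => x; rewrite kM ?normr0// (lt_le_trans M0).
have [||c cM cmax] := @EVT_max R (fun x => `|k x|) (- M) M.
- by rewrite ge0_cp.
-
  apply: continuous_subspaceT => x; apply: continuous_comp; first exact: ck.
  exact: norm_continuous.
- exists `|k c| => x; have [/kM->|xM] := ltP M `|x|; first by rewrite normr0.
  by apply: cmax; rewrite in_itv/= -ler_norml.
Qed.

Lemma bump_fun_continuous : continuous (@bump_fun R).
Proof.
have /ccontinuousP[cb _] := @smooth_continuous _ _ 0 (@smooth_bump_fun R).
exact: cb.
Qed.

Lemma bump_fun_integrable : mu.-integrable [set: R] (EFin \o @bump_fun R).
Proof.
have mb := continuous_measurable_fun bump_fun_continuous.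
have [|C hC] := @bounded_bump (@bump_fun R) 1 bump_fun_continuous.
  move=> x; case: (leP 0 x) => [x0|x0]; last by rewrite bump_fun_le0// ltW.
  by rewrite ger0_norm// => x1; rewrite bump_fun_ge1// ltW.
have [||//] := @integrable_bump (@bump_fun R) 0 1 C mb ler01 hC.
  by move=> x x0; rewrite bump_fun_le0// ltW.
by move=> x x0; rewrite bump_fun_ge1// ltW.
Qed.

Lemma FTC_Ny (k : R -> R) (x : R) :
  continuous k -> (forall y, mu.-integrable `]-oo, y] (EFin \o k)) ->
  is_derive x 1 (fun y => \int[mu]_(t in `]-oo, y]) k t) (k x).
Proof.
move=> ck ik.
(* Any right end beyond [x] would do. *)
have [||||dk dkE] := @continuous_FTC1 R k -oo%O x (x + 1).
- by rewrite ltrDl.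
- exact: ik.
- exact: ltNyr.
- exact: ck.
by rewrite -dkE derive1E; exact: DeriveDef.
Qed.

Definition bump_primitive (x : R) := \int[mu]_(t in `]-oo, x]) bump_fun t.

Lemma bump_primitive_derive (x : R) : is_derive x 1 bump_primitive (bump_fun x).
Proof.
apply: FTC_Ny; first exact: bump_fun_continuous.
by move=> y; apply: integrableS bump_fun_integrable.
Qed.

Lemma bump_primitive_MVT (a b : R) : a < b ->
  exists2 c, c \in `]a, b[ &
    bump_primitive b - bump_primitive a = bump_fun c * (b - a).
Proof.
move=> ab; apply: (@MVT R bump_primitive (@bump_fun R)) => //.
  by move=> x _; exact: bump_primitive_derive.
apply: derivable_within_continuous => x _.
by case: (bump_primitive_derive x).
Qed.

(** [theta] is the primitive of the bump divided by its total mass, which is P(1) since the bump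
    lives on [0, 1]; [rho] is the bump divided by the same mass. *)
Lemma smooth_step_exists : exists (theta rho : R -> R),
  [/\ smooth (fun x => (theta x)%:C), smooth (fun x => (rho x)%:C),
      forall x : R, is_derive x 1 theta (rho x),
      forall x, 0 <= theta x <= 1 &
   [/\ forall x, x <= 0 -> theta x = 0, forall x, 1 <= x -> theta x = 1,
      forall x, x <= 0 -> rho x = 0 & forall x, 1 <= x -> rho x = 0]].
Proof.
pose P := bump_primitive.
have Pmono a b : a <= b -> P a <= P b.
  rewrite le_eqVlt => /orP[/eqP->//|ab].
  have [c _ Pc] := bump_primitive_MVT ab.
  by rewrite -subr_ge0 Pc mulr_ge0 ?bump_fun_ge0// subr_ge0 ltW.
have P0 x : x <= 0 -> P x = 0.
  move=> x0; rewrite /P /bump_primitive.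
  under eq_Rintegral.
    move=> y; rewrite inE/= in_itv/= => yx.
    rewrite bump_fun_le0 ?(le_trans yx)//.
    over.
  by rewrite /Rintegral /= integral0.
have P1 x : 1 <= x -> P x = P 1.
  rewrite le_eqVlt => /orP[/eqP->//|x1].
  have [c /[!in_itv]/= /andP[c1 _] Pc] := bump_primitive_MVT x1.
  by apply/eqP; rewrite -subr_eq0 Pc bump_fun_ge1 ?mul0r// ltW.
have P1gt0 : 0 < P 1.
  have [c /[!in_itv]/= /andP[c0 c1]] := bump_primitive_MVT (@ltr01 R).
  rewrite -/P (P0 0)// !subr0 mulr1 => ->; exact: bump_fun_gt0.
pose theta x := (P 1)^-1 * P x; pose rho x := (P 1)^-1 * bump_fun x.
have dtheta (x : R) : is_derive x 1 theta (rho x).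
  have := @is_deriveZ _ _ _ P (P 1)^-1 x 1 _ (bump_primitive_derive x).
  by [].
have srho : smooth (fun x => (rho x)%:C).
  have -> : (fun x => (rho x)%:C) = ((P 1)^-1)%:C *: (fun x => (bump_fun x)%:C).
    apply/funext => x; apply: complex_ext;
      rewrite /= ?mulr0 ?mul0r ?subr0 ?addr0//.
  exact/smoothZ/smooth_bump_fun.
exists theta, rho; split=> //; last split.
- pose F n := if n is n'.+1 then cderivn n' (fun x => (rho x)%:C)
              else fun x => (theta x)%:C.
  have [] // := @smooth_seq R F.
  case=> [|n] x; first exact: is_cderive_real.
  exact: smooth_is_cderive.
- move=> x; rewrite /theta mulr_ge0 ?invr_ge0 ?(ltW P1gt0)//=; last first.
    by case: (leP 0 x) => [/Pmono|/ltW/P0 ->//]; rewrite P0.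
  rewrite -ler_pdivlMl ?invr_gt0// invrK mulr1.
  by case: (leP x 1) => [/Pmono//|/ltW/P1 ->].
- by move=> x /P0; rewrite /theta => ->; rewrite mulr0.
- by move=> x /P1; rewrite /theta => ->; rewrite mulVf// gt_eqF.
- by move=> x x0; rewrite /rho bump_fun_le0// mulr0.
- by move=> x x0; rewrite /rho bump_fun_ge1// mulr0.
Qed.

End smooth_step_construction.

(** * Inverting 1 + d/dx on integrable functions *)
Section resolvent.
Variable R : realType.
Notation mu := (@lebesgue_measure R).
Implicit Types (k : R -> R) (v w : R -> R[i]).

Lemma is_derive_continuous (f df : R -> R) :
  (forall x : R, is_derive x 1 f (df x)) -> continuous f.
Proof.
move=> dF x; apply/differentiable_continuous/derivable1_diffP.
by case: (dF x).
Qed.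

Lemma FTC2 (f df : R -> R) (a b : R) : a < b ->
  (forall x : R, is_derive x 1 f (df x)) -> continuous df ->
  (\int[mu]_(x in `[a, b]) (df x)%:E = (f b - f a)%:E)%E.
Proof.
move=> ab dF cdf; rewrite EFinB; have cf := is_derive_continuous dF.
apply: continuous_FTC2 => //.
- exact: continuous_subspaceT.
- split; first by move=> x _; case: (dF x).
    by apply: cvg_at_right_filter; exact: cf.
  by apply: cvg_at_left_filter; exact: cf.
- by move=> x _; rewrite derive1E; case: (dF x).
Qed.

Definition exp_weighted k (t : R) : R := expR t * k t.

(* The solution of [w + w' = k] given by [w(x) = e^(-x) \int_(-oo)^x e^t k(t) dt]. *)
Definition real_resolvent k (x : R) : R :=
  expR (- x) * \int[mu]_(t in `]-oo, x]) exp_weighted k t.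

(** The weight e^t is at most e^y on the half-line, so integrability of [k] is enough. *)
Lemma integrable_Ny k (y : R) : continuous k ->
  mu.-integrable [set: R] (EFin \o k) ->
  mu.-integrable `]-oo, y] (EFin \o exp_weighted k).
Proof.
move=> ck ik.
have ig : mu.-integrable `]-oo, y] (EFin \o (fun t => expR y * k t)).
  by apply: integrableS (integrableRZ (expR y) ik).
apply: le_integrable ig => //.
  have cg : continuous (exp_weighted k).
    by move=> t; apply: continuousM; [exact: continuous_expR|exact: ck].
  have mg := continuous_measurable_fun cg.
  by apply/measurable_EFinP; exact: measurable_funTS.
move=> t /=; rewrite in_itv/= => ty.
by rewrite lee_fin !normrM ler_wpM2r// !ger0_norm ?expR_ge0// ler_expR.
Qed.

Lemma is_derive_real_resolvent k (x : R) : continuous k ->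
  mu.-integrable [set: R] (EFin \o k) ->
  is_derive x 1 (real_resolvent k) (k x - real_resolvent k x).
Proof.
move=> ck ik.
have cg : continuous (exp_weighted k).
  by move=> t; apply: continuousM; [exact: continuous_expR|exact: ck].
have dP := FTC_Ny x cg (fun y => integrable_Ny y ck ik).
have de := @is_derive1_comp _ expR (fun y : R => - y) x _ _
   (is_derive_expR _) (is_deriveN (is_derive_id _ _)).
apply: is_derive_eq (is_deriveM de dP) _.
rewrite /GRing.scale/= /real_resolvent /exp_weighted mulrA -expRD addNr expR0.
ring.
Qed.

Lemma real_resolvent_le k (x : R) : continuous k ->
  mu.-integrable [set: R] (EFin \o k) ->
  `|real_resolvent k x| <= real_resolvent (fun t => `|k t|) x.
Proof.
move=> ck ik; rewrite /real_resolvent normrM ger0_norm ?expR_ge0//.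
rewrite ler_wpM2l ?expR_ge0//.
rewrite (le_trans (le_normr_Rintegral _ (integrable_Ny x ck ik)))//.
rewrite le_eqVlt; apply/orP; left; apply/eqP.
apply: eq_Rintegral => t _.
by rewrite /exp_weighted normrM [X in X * _]ger0_norm ?expR_ge0.
Qed.

Lemma real_resolvent_ge0 k (x : R) : (forall t, 0 <= k t) ->
  0 <= real_resolvent k x.
Proof.
move=> k0; rewrite mulr_ge0 ?expR_ge0//; apply: Rintegral_ge0 => t _.
by rewrite mulr_ge0 ?expR_ge0.
Qed.

Lemma real_resolvent_bound k (x : R) : continuous k ->
  mu.-integrable [set: R] (EFin \o k) -> (forall t, 0 <= k t) ->
  real_resolvent k x <= \int[mu]_t k t.
Proof.
move=> ck ik k0; rewrite /real_resolvent.
have ikx : mu.-integrable `]-oo, x] (EFin \o k) by apply: integrableS ik.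
rewrite -RintegralZl//; last exact: integrable_Ny.
apply: (@le_trans _ _ (\int[mu]_(t in `]-oo, x]) k t)).
  apply: le_Rintegral => //.
    rewrite (_ : _ \o _ = (fun t => (expR (- x))%:E *
      (EFin \o exp_weighted k) t)%E)//.
    by apply: integrableZl => //; exact: integrable_Ny.
  move=> t /=; rewrite in_itv/= => tx.
  by rewrite /exp_weighted mulrA -expRD ler_piMl// expR_le1 addrC subr_le0.
rewrite /Rintegral fine_le//.
- exact: integrable_fin_num.
- exact: integrable_fin_num.
- apply: ge0_subset_integral => //; last by move=> t _; rewrite lee_fin.
  by case/integrableP: ik.
Qed.

Lemma real_resolvent_continuous k : continuous k ->
  mu.-integrable [set: R] (EFin \o k) -> continuous (real_resolvent k).
Proof.
move=> ck ik; apply: (@is_derive_continuous _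
  (fun x => k x - real_resolvent k x)).
by move=> x; exact: is_derive_real_resolvent.
Qed.

(** Fubini is bypassed by integrating the equation W = k - W'. Over [-n, n] this gives at most I -
    W(n) + W(-n), where I is the integral of k, and 0 <= W <= I bounds it by 2 I; monotone
    convergence lets n grow. The loss with respect to the sharp constant 1 is harmless. *)
Lemma real_resolvent_integral k : continuous k ->
  mu.-integrable [set: R] (EFin \o k) -> (forall t, 0 <= k t) ->
  (\int[mu]_x (real_resolvent k x)%:E <= (2 * \int[mu]_t k t)%:E)%E.
Proof.
move=> ck ik k0; pose W := real_resolvent k; pose I := \int[mu]_t k t.
have cW : continuous W by exact: real_resolvent_continuous.
have mW : measurable_fun [set: R] (EFin \o W).
  by have m := continuous_measurable_fun cW; exact/measurable_EFinP.
pose F (n : nat) : set R := [set` `[- n%:R : R, n%:R]].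
have FT : \bigcup_n F n = [set: R].
  apply/seteqP; split=> // x _; exists (Num.bound `|x|) => //=.
  by rewrite /F/= in_itv/= -ler_norml ltW// archi_boundP.
have W0 x : 0 <= W x by exact: real_resolvent_ge0.
have Fle n : (\int[mu]_(x in F n) (W x)%:E <= (2 * I)%:E)%E.
  have I0 : 0 <= I by exact: Rintegral_ge0.
  (* The interval [0, 0] is set apart because the fundamental theorem is applied on a nondegenerate
     interval. *)
  case: n => [|n].
    by rewrite /F oppr0 set_itv1 integral_set1 lee_fin mulr_ge0.
  pose G x := \int[mu]_(t in `]-oo, x]) k t - W x.
  have dG (x : R) : is_derive x 1 G (W x).
    have dP := FTC_Ny x ck (fun y => integrableS _ _ _ ik).
    apply: is_derive_eq (is_deriveB (dP _ _ _)
      (is_derive_real_resolvent x ck ik)) _ => //.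
    by rewrite opprB addrC subrK.
  have nn : - n.+1%:R < n.+1%:R :> R by rewrite gtrN// ltr0n.
  rewrite /F (FTC2 nn dG cW) lee_fin /G.
  have PI x : 0 <= \int[mu]_(t in `]-oo, x]) k t <= I.
    rewrite Rintegral_ge0//= /Rintegral fine_le//.
    + by apply: integrable_fin_num => //; apply: integrableS ik.
    + exact: integrable_fin_num.
    + apply: ge0_subset_integral => //; last by move=> t _; rewrite lee_fin.
      by case/integrableP: ik.
  have L (p q r s J : R) : 0 <= p -> q <= J -> r <= J -> 0 <= s ->
    r - p - (s - q) <= 2 * J by move=> *; lra.
  have /andP[_ Ir] := PI n.+1%:R; have /andP[Is _] := PI (- n.+1%:R).
  exact: L (W0 _) (real_resolvent_bound _ ck ik k0) Ir Is.
have Fmono : {homo F : n m / (n <= m)%N >-> (n <= m)%O}.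
  move=> n m nm; apply/subsetPset => x; rewrite /F /= !in_itv/= => /andP[nx xn].
  have nmR : n%:R <= m%:R :> R by rewrite ler_nat.
  by rewrite (le_trans _ nx) ?lerN2// (le_trans xn).
have cv := @ge0_nondecreasing_set_cvg_integral _ (measurableTypeR R) R F
  (EFin \o W) mu Fmono.
have {}cv := cv (fun n => measurable_itv _) (fun n => measurable_funTS mW)
  (fun n x _ => W0 x).
rewrite FT in cv; rewrite -(cvg_lim _ cv)//.
apply: lime_le; last by apply: nearW => n; exact: Fle.
by apply/cvg_ex; eexists; exact: cv.
Qed.

Definition resolvent v (x : R) : R[i] :=
  real_resolvent (fun t => complex.Re (v t)) x +i*
  real_resolvent (fun t => complex.Im (v t)) x.

Lemma cL1_integrable_parts v : cL1 v ->
  mu.-integrable [set: R] (EFin \o (fun t => complex.Re (v t))) /\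
  mu.-integrable [set: R] (EFin \o (fun t => complex.Im (v t))).
Proof.
move=> v1; have [] := @cintegrable_dom _ v (cabs v) _ (cL1_integrable v1).
- by apply: continuous_cmeasurable; case: v1.
- by [].
- by [].
Qed.

Lemma is_cderive_resolvent v x : cL1 v ->
  is_cderive (resolvent v) x (v x - resolvent v x).
Proof.
move=> v1; have [i1 i2] := cL1_integrable_parts v1.
have [/ccontinuousP[c1 c2] _] := v1.
apply/cis_derivP; rewrite ReD ImD ReN ImN.
by split; exact: is_derive_real_resolvent.
Qed.

Lemma resolvent_continuous v : cL1 v ->
  continuous (resolvent v : R -> Rcomplex R).
Proof.
move=> v1 x; apply/differentiable_continuous/derivable1_diffP.
by case: (is_cderive_resolvent x v1).
Qed.

Lemma real_resolvent_abs k : continuous k ->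
  mu.-integrable [set: R] (EFin \o k) ->
  mu.-integrable [set: R] (EFin \o real_resolvent (fun t => `|k t|)) /\
  \int[mu]_x real_resolvent (fun t => `|k t|) x <= 2 * \int[mu]_t `|k t|.
Proof.
move=> ck ik; set a := fun t => `|k t|.
have ca : continuous a.
  by move=> t; apply: continuous_comp; [exact: ck|exact: norm_continuous].
have ia : mu.-integrable [set: R] (EFin \o a) by exact: integrable_norm.
have a0 t : 0 <= a t by exact: normr_ge0.
have le2 := real_resolvent_integral ca ia a0.
have i : mu.-integrable [set: R] (EFin \o real_resolvent a).
  apply/integrableP; split.
    have m := continuous_measurable_fun (real_resolvent_continuous ca ia).
    exact/measurable_EFinP.
  apply: le_lt_trans (ltry (2 * \int[mu]_t a t)); apply: le_trans le2.
  rewrite le_eqVlt; apply/orP; left; apply/eqP; apply: eq_integral => x _ /=.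
  by rewrite ger0_norm// real_resolvent_ge0.
split=> //; rewrite -lee_fin.
have -> : (\int[mu]_x real_resolvent a x)%:E =
    (\int[mu]_x (real_resolvent a x)%:E)%E.
  by rewrite fineK//; exact: integrable_fin_num.
exact: le2.
Qed.

(** The constant 4 is a factor 2 for the real resolvent times 2 for the two parts, each of which is
    at most |v|. *)
Lemma cL1_resolvent v : cL1 v -> cL1 (resolvent v) /\ l1
  (resolvent v) <= 4 * l1 v.
Proof.
move=> v1; have [i1 i2] := cL1_integrable_parts v1.
have [/ccontinuousP[c1 c2] _] := v1.
have [r1 l1r] := real_resolvent_abs c1 i1.
have [r2 l2r] := real_resolvent_abs c2 i2.
have [|Jv Jle] := cL1_dom (resolvent_continuous v1) (integrableRD r1 r2).
  move=> x; apply: (le_trans (cmod_le _)).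
  by apply: lerD; exact: real_resolvent_le.
split=> //; apply: (le_trans Jle); rewrite RintegralD//.
have n1 : \int[mu]_t `|complex.Re (v t)| <= l1 v.
  apply: le_Rintegral => //; [exact: integrable_norm|exact: cL1_integrable|].
  by move=> t _; exact: ler_Re.
have n2 : \int[mu]_t `|complex.Im (v t)| <= l1 v.
  apply: le_Rintegral => //; [exact: integrable_norm|exact: cL1_integrable|].
  by move=> t _; exact: ler_Im.
have L (p q r s J : R) : r <= 2 * p -> s <= 2 * q -> p <= J -> q <= J ->
  r + s <= 4 * J by move=> *; lra.
exact: L l1r l2r n1 n2.
Qed.

(** Since r(x) = c e^(-x), one has |r| >= |c| on [-n, 0], so |c| n is at most the integral of |r|
    for every n, which forces c = 0. *)
Lemma real_decay_eq0 (r : R -> R) : (forall x : R, is_derive x 1 r (- r x)) ->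
  mu.-integrable [set: R] (EFin \o r) -> forall x, r x = 0.
Proof.
move=> dr ir; pose c := r 0.
have rE x : expR x * r x = c.
  rewrite /c -[r 0]mul1r -expR0.
  apply: (@is_derive_0_is_cst _ (fun x => expR x * r x)) => y.
  apply: is_derive_eq (is_deriveM (is_derive_expR y) (dr y)) _.
  by rewrite /GRing.scale/=; ring.
suff c0 : c = 0.
  by move=> x; apply/eqP; have /eqP := rE x;
    rewrite c0 mulf_eq0 gt_eqF ?expR_gt0.
have le n : `|c| * n%:R <= \int[mu]_x `|r x|.
  have /= iI := integrable_indic_itv (- n%:R : R) (0 : R) true false.
  apply: (@le_trans _ _ (\int[mu]_x
    (`|c| * \1_(`[- n%:R, 0]%classic : set R) x))).
    by rewrite RintegralZl// Rintegral_indic_itv ?oppr_le0// sub0r opprK.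
  apply: le_Rintegral => //; [exact: integrableRZ|exact: integrable_norm|].
  move=> x _; rewrite indicE; case: (boolP (_ \in _)) => [|_];
    last by rewrite mulr0.
  rewrite inE/= in_itv/= mulr1 => /andP[_ x0].
  rewrite -(rE x) normrM ger0_norm ?expR_ge0// ler_piMl//.
  by rewrite expR_le1.
apply/eqP; rewrite -normr_eq0 eq_le normr_ge0 andbT leNgt; apply/negP => c0.
set I := \int[mu]_x `|r x| in le.
have := le (Num.bound (I / `|c|)); apply/negP;
  rewrite -ltNge mulrC -ltr_pdivrMr//.
apply: le_lt_trans (archi_boundP _); first exact: lexx.
by rewrite divr_ge0//; exact: Rintegral_ge0.
Qed.

(* The solutions of [w' = - w] are multiples of [e^(-x)], none of which is
   integrable but [0]; this makes the resolvent the inverse of [1 + d/dx]. *)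
Lemma decay_eq0 w : cL1 w -> (forall x, is_cderive w x (- w x)) -> w = 0.
Proof.
move=> w1 dw; have [i1 i2] := cL1_integrable_parts w1.
apply/funext => x; apply: complex_ext => /=.
  apply: (real_decay_eq0 _ i1) => y.
  by have /cis_derivP[+ _] := dw y; rewrite ReN.
apply: (real_decay_eq0 _ i2) => y.
by have /cis_derivP[_ +] := dw y; rewrite ImN.
Qed.

Lemma resolvent_unique v w : cL1 v -> cL1 w ->
  (forall x, is_cderive w x (v x - w x)) -> w = resolvent v.
Proof.
move=> v1 w1 dw; apply/eqP; rewrite -subr_eq0; apply/eqP.
have [J1 _] := cL1_resolvent v1.
have E : w - resolvent v = (-1) *: resolvent v + w.
  by rewrite scaleN1r addrC.
apply: decay_eq0; first by rewrite E; exact: cL1_lin.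
move=> x; have := is_cderiveB (dw x) (is_cderive_resolvent x v1).
congr is_cderive.
rewrite (_ : (w - resolvent v) x = w x - resolvent v x)//.
by rewrite !opprB addrC addrA subrK.
Qed.

End resolvent.

(** * Forms of finite order on D_(L^1) *)
Section bounded_forms.
Variable R : realType.
Implicit Types (f g v w : R -> R[i]) (V : (R -> R[i]) -> R[i]).

Lemma DL1_cL1 i f : DL1_set f -> cL1 (cderivn i f).
Proof. by move=> [sf f1]; split; [exact: smooth_continuous|exact: f1]. Qed.

Lemma DL1_lin (a : R[i]) f g : DL1_set f -> DL1_set g -> DL1_set (a *: f + g).
Proof.
move=> df dg; split; first by apply: smooth_lin; [case: df|case: dg].
move=> i; rewrite cderivn_lin; [|by case: df|by case: dg].
by have [] := cL1_lin a (DL1_cL1 i df) (DL1_cL1 i dg).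
Qed.

Lemma DL1_0 : DL1_set (0 : R -> R[i]).
Proof. by split; [exact: smooth0|move=> i; rewrite cderivn0 L1norm0 ltry]. Qed.

Lemma DL1Z (a : R[i]) f : DL1_set f -> DL1_set (a *: f).
Proof. by move=> df; rewrite -[a *: f]addr0; apply: DL1_lin => //;
  exact: DL1_0. Qed.

Lemma DL1D f g : DL1_set f -> DL1_set g -> DL1_set (f + g).
Proof. by move=> df dg; rewrite -[f]scale1r; exact: DL1_lin. Qed.

Lemma DL1B f g : DL1_set f -> DL1_set g -> DL1_set (f - g).
Proof.
move=> df dg; have -> : f - g = (-1) *: g + f by rewrite scaleN1r addrC.
exact: DL1_lin.
Qed.

Lemma DL1_cderivn n f : DL1_set f -> DL1_set (cderivn n f).
Proof.
move=> [sf f1]; split; first exact: smooth_cderivn.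
by move=> i; rewrite cderivnD.
Qed.

Lemma smooth_reflect (x : R) f : smooth f -> smooth (fun y => f (x - y)).
Proof.
move=> sf; have -> : (fun y => f (x - y)) = (fun y => f (-1 * y + x)).
  by apply/funext => y; rewrite mulN1r addrC.
exact: smooth_affine.
Qed.

Lemma cderivn_reflect n (x : R) f : smooth f ->
  cderivn n (fun y => f (x - y)) =
    ((-1) ^+ n : R[i]) *: (fun y => cderivn n f (x - y)).
Proof.
move=> sf; have -> : (fun y => f (x - y)) = (fun y => f (-1 * y + x)).
  by apply/funext => y; rewrite mulN1r addrC.
rewrite cderivn_affine//; apply/funext => y; rewrite mulN1r [- y + x]addrC.
rewrite -[RHS]/((-1) ^+ n * cderivn n f (x - y)).
rewrite -[in LHS]signr_odd -[in RHS]signr_odd; case: odd; rewrite ?expr0 ?expr1.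
  by rewrite scaleN1r mulN1r.
by rewrite scale1r mul1r.
Qed.

Lemma cmod_sign n : cmod ((-1) ^+ n : R[i]) = 1.
Proof.
rewrite -signr_odd; case: odd; rewrite ?expr0 ?expr1 /cmod /Num.norm/=.
  by rewrite oppr0 expr0n addr0 sqrrN expr1n sqrtr1.
by rewrite expr0n addr0 expr1n sqrtr1.
Qed.

Lemma cL1Z (a : R[i]) f : cL1 f -> cL1 (a *: f).
Proof. by move=> f1; rewrite -[a *: f]addr0; apply: cL1_lin => //;
  exact: cL10. Qed.

Lemma l1Z (a : R[i]) f : cL1 f -> l1 (a *: f) = cmod a * l1 f.
Proof.
move=> f1; rewrite /l1 -RintegralZl//; last exact: cL1_integrable.
by apply: eq_Rintegral => x _; exact: cmodM.
Qed.

Lemma l1B f g : cL1 f -> cL1 g -> l1 (f - g) <= l1 f + l1 g.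
Proof.
move=> f1 g1; have -> : f - g = (-1) *: g + f by rewrite scaleN1r addrC.
have := l1_lin (-1) g1 f1; have := cmod_sign 1; rewrite expr1 => ->.
by rewrite mul1r [l1 g + _]addrC.
Qed.

Lemma cL1_reflect (x : R) f : cL1 f -> cL1 (fun y => f (x - y)).
Proof.
move=> [cf f1]; split; last by rewrite L1norm_reflect.
move=> y; apply: (@continuous_comp _ _ _ (fun y => x - y) (f : R ->
  Rcomplex R)).
  by apply: continuousB; [exact: cvg_cst|exact: cvg_id].
exact: cf.
Qed.

Lemma DL1_reflect (x : R) f : DL1_set f -> DL1_set (fun y => f (x - y)).
Proof.
move=> df; split; first by apply: smooth_reflect; case: df.
move=> i; rewrite cderivn_reflect; last by case: df.
by have [_] := cL1Z ((-1) ^+ i) (cL1_reflect x (DL1_cL1 i df)).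
Qed.

Lemma l1_cderivn_reflect i (x : R) f : DL1_set f ->
  l1 (cderivn i (fun y => f (x - y))) = l1 (cderivn i f).
Proof.
move=> df; have [sf _] := df.
rewrite cderivn_reflect// l1Z ?cmod_sign ?mul1r ?l1_reflect//.
- exact: smooth_continuous.
- exact/cL1_reflect/DL1_cL1.
Qed.

(** The W^(m,1) norm: [DL1_norm] with real values and on bare functions. *)
Definition sobolev m f : R := \sum_(i < m.+1) l1 (cderivn i f).

Lemma sobolev_ge0 m f : 0 <= sobolev m f.
Proof. by apply: sumr_ge0 => i _; exact: l1_ge0. Qed.

Lemma sobolev0 f : sobolev 0 f = l1 f.
Proof. by rewrite /sobolev big_ord_recl big_ord0 addr0. Qed.

Lemma l1_le_sobolev i m f : (i <= m)%N -> l1 (cderivn i f) <= sobolev m f.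
Proof.
move=> im; rewrite /sobolev (bigD1 (Ordinal (im : i < m.+1)%N))//= lerDl.
by apply: sumr_ge0 => j _; exact: l1_ge0.
Qed.

Lemma sobolev_reflect m (x : R) f : DL1_set f ->
  sobolev m (fun y => f (x - y)) = sobolev m f.
Proof. by move=> df; apply: eq_bigr => i _; exact: l1_cderivn_reflect. Qed.

Lemma DL1_resolvent v : DL1_set v ->
  [/\ DL1_set (resolvent v), l1 (resolvent v) <= 4 * l1 v &
      forall n, cderivn n.+1 (resolvent v) =
        cderivn n v - cderivn n (resolvent v)].
Proof.
move=> dv; have v1 : cL1 v := DL1_cL1 0 dv.
have [sJ dJ] := smooth_ode (proj1 dv) (fun x => is_cderive_resolvent x v1).
have [J1 Jle] := cL1_resolvent v1.
split=> //; split=> // i.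
suff [] : cL1 (cderivn i (resolvent v)) by [].
elim: i => // i IH; rewrite dJ.
have -> : cderivn i v - cderivn i (resolvent v) =
  (-1) *: cderivn i (resolvent v) + cderivn i v by rewrite scaleN1r addrC.
by apply: cL1_lin => //; exact: DL1_cL1.
Qed.

(** The working characterisation of the resolvent: its linearity, its inversion of 1 + d/dx and its
    compatibility with reflections are all obtained by checking the differential equation, never by
    manipulating the integral. *)
Lemma resolvent_uniqueD v w : DL1_set v -> DL1_set w ->
  cderivn 1 w = v - w -> w = resolvent v.
Proof.
move=> dv dw E; apply: resolvent_unique.
- exact: (DL1_cL1 0 dv).
- exact: (DL1_cL1 0 dw).
- move=> x; rewrite -[v x - w x]/((v - w) x) -E.
  by apply: (@smooth_is_cderive _ _ 0); case: dw.
Qed.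

Lemma resolvent_lin (a : R[i]) v w : DL1_set v -> DL1_set w ->
  resolvent (a *: v + w) = a *: resolvent v + resolvent w.
Proof.
move=> dv dw; have [dJv _ Ev] := DL1_resolvent dv.
have [dJw _ Ew] := DL1_resolvent dw.
apply/esym/resolvent_uniqueD; [exact: DL1_lin|exact: DL1_lin|].
rewrite cderivn_lin; [|by case: dJv|by case: dJw].
by rewrite Ev Ew scalerBr opprD addrACA.
Qed.

Lemma resolvent_addD v : DL1_set v -> resolvent (v + cderivn 1 v) = v.
Proof.
move=> dv; apply/esym/resolvent_uniqueD => //.
  exact/DL1D/DL1_cderivn.
by rewrite addrAC subrr add0r.
Qed.

Lemma resolvent_deriv v : DL1_set v ->
  resolvent (cderivn 1 v) = v - resolvent v.
Proof.
move=> dv; have := resolvent_addD dv.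
rewrite -{1}[v]scale1r resolvent_lin//; last exact: DL1_cderivn.
by rewrite scale1r => H; apply/eqP; rewrite eq_sym subr_eq addrC H.
Qed.

(** Commutation with translations, since v(x - .) is the translate by x of v(-.). The double
    reflection displays the right-hand side as psi(x - y) for a fixed psi, which is the shape that
    [aa_form] asks for. *)
Lemma resolvent_reflect (x : R) v : DL1_set v ->
  resolvent (fun y => v (x - y)) =
  (fun y => resolvent (fun z => v (0 - z)) (0 - (x - y))).
Proof.
move=> dv; have dr := DL1_reflect 0 dv.
have [dJ _ E] := DL1_resolvent dr.
apply/esym/resolvent_uniqueD.
- exact: DL1_reflect.
- exact/(@DL1_reflect x (fun z => resolvent (fun z => v (0 - z))
  (0 - z)))/DL1_reflect.
have sJ := proj1 dJ.
rewrite (@cderivn_reflect 1 x (fun z => resolvent (fun z => v (0 - z))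
  (0 - z))).
  rewrite (@cderivn_reflect 1 0) // E.
  apply/funext => y; rewrite expr1.
  rewrite -[LHS]/(-1 * (-1 * (v (0 - (0 - (x - y))) - resolvent (fun z => v
    (0 - z)) (0 - (x - y))))).
  have xy : 0 - (0 - (x - y)) = x - y by rewrite !sub0r opprK.
  by rewrite !mulN1r opprK {1}xy.
by apply: smooth_reflect.
Qed.

Lemma sobolev_resolvent0 v : DL1_set v ->
  sobolev 0 (resolvent v) <= 4 * sobolev 0 v.
Proof. by move=> dv; rewrite !sobolev0; have [] := DL1_resolvent dv. Qed.

Lemma sobolev_resolvent m v : DL1_set v ->
  sobolev m.+1 (resolvent v) <= (m.+2%:R * (4 + m.+1%:R)) * sobolev m v.
Proof.
move=> dv; have [dJ J4 E] := DL1_resolvent dv.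
(* Each use of w^(i+1) = v^(i) - w^(i) costs one more copy of the norm of [v], starting from the 4
   of the L^1 bound. The final constant is this bound at i = m + 1 times the number m + 2 of
   terms. *)
have b i : (i <= m.+1)%N -> l1 (cderivn i (resolvent v)) <=
  (4 + i%:R) * sobolev m v.
  elim: i => [_|i IH im].
    rewrite addr0 (le_trans J4)// ler_pM2l//.
    exact: (@l1_le_sobolev 0).
  rewrite E (le_trans (l1B (DL1_cL1 i dv) (DL1_cL1 i dJ)))//.
  rewrite -[i.+1%:R]natr1 addrA mulrDl mul1r [leRHS]addrC lerD//;
    first exact: l1_le_sobolev.
  exact/IH/ltnW.
apply: (@le_trans _ _ (\sum_(i < m.+2) (4 + m.+1%:R) * sobolev m v)).
  apply: ler_sum => -[i /= im] _; apply: (le_trans (b i _)) => //.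
  by rewrite ler_wpM2r ?sobolev_ge0// lerD2l ler_nat.
by rewrite sumr_const card_ord -mulrA mulr_natl.
Qed.

(* A form of order at most [m]; only its values on [DL1_set] are meaningful. *)
Definition bounded_form m V :=
  (forall (a : R[i]) f g, DL1_set f -> DL1_set g ->
    V (a *: f + g) = a * V f + V g) /\
  exists2 C, 0 <= C & forall f, DL1_set f -> cmod (V f) <= C * sobolev m f.

(* [w' = v - w] trades a derivative of [resolvent v] for none of [v], so the
   order drops by one. *)
Lemma bounded_form_resolvent m V : bounded_form m.+1 V ->
  bounded_form m (V \o @resolvent R).
Proof.
move=> [lV [C C0 VC]]; split=> [a f g df dg|].
  rewrite /= resolvent_lin// lV//; [by have [] := DL1_resolvent df|
                                   by have [] := DL1_resolvent dg].
exists (C * (m.+2%:R * (4 + m.+1%:R))).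
  by rewrite mulr_ge0// mulr_ge0// addr_ge0.
move=> f df; have [dJ _ _] := DL1_resolvent df.
by rewrite -mulrA (le_trans (VC _ dJ))// ler_wpM2l// sobolev_resolvent.
Qed.

(** At order 0 there is no order left to lose; this case serves the last resolvent, the one that
    produces a continuous density. *)
Lemma bounded_form_resolvent0 V : bounded_form 0 V ->
  bounded_form 0 (V \o @resolvent R).
Proof.
move=> [lV [C C0 VC]]; split=> [a f g df dg|].
  rewrite /= resolvent_lin// lV//; [by have [] := DL1_resolvent df|
                                   by have [] := DL1_resolvent dg].
exists (C * 4); first by rewrite mulr_ge0.
move=> f df; have [dJ _ _] := DL1_resolvent df.
by rewrite -mulrA (le_trans (VC _ dJ))// ler_wpM2l// sobolev_resolvent0.
Qed.

Lemma bounded_formB m V f g : bounded_form m V -> DL1_set f -> DL1_set g ->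
  V (f - g) = V f - V g.
Proof.
move=> [lV _] df dg; have -> : f - g = (-1) *: g + f by rewrite scaleN1r addrC.
by rewrite lV// mulN1r addrC.
Qed.

Lemma bounded_formD m V f g : bounded_form m V -> DL1_set f -> DL1_set g ->
  V (f + g) = V f + V g.
Proof. by move=> [lV _] df dg; rewrite -{1}[f]scale1r lV// mul1r. Qed.

Lemma bounded_form0 m V : bounded_form m V -> V 0 = 0.
Proof.
move=> bV; rewrite -[X in V X](subrr 0) (bounded_formB bV) ?subrr//;
  exact: DL1_0.
Qed.

Lemma bounded_formZ m V (a : R[i]) f : bounded_form m V -> DL1_set f ->
  V (a *: f) = a * V f.
Proof.
move=> bV df; have [lV _] := bV; rewrite -[a *: f]addr0 lV//; last exact: DL1_0.
by rewrite (bounded_form0 bV) addr0.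
Qed.

Lemma mem_in_DL1 f : DL1_set f -> f \in @in_DL1 R.
Proof. by move=> df; rewrite unfold_in inE. Qed.

(** Acting on bare functions keeps membership proofs out of the terms when functions are reflected,
    multiplied or passed to the resolvent. The value 0 outside [DL1_set] is a placeholder. *)
Definition form_of_dual (U : DL1 R -> R[i]) (f : R -> R[i]) : R[i] :=
  if pselect (DL1_set f) is left df then
    U (MkDL1 (mem_in_DL1 df))
  else 0.

End bounded_forms.

(** * Continuous linear forms have finite order *)

Section forms_of_dual.
Variable R : realType.
Implicit Types (f g v w : R -> R[i]) (U : DL1 R -> R[i]).

Lemma form_of_dualE U f (df : DL1_set f) :
  form_of_dual U f = U (MkDL1 (mem_in_DL1 df)).
Proof.
rewrite /form_of_dual; case: pselect => // df'.
by congr U; exact: val_inj.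
Qed.

Lemma test_DL1_set (u : testfun R) : DL1_set (u : R -> R[i]).
Proof. by have := test_DL1_subproof u; rewrite unfold_in inE. Qed.

Lemma form_of_dual_test U (u : testfun R) :
  form_of_dual U u = U (test_DL1 u).
Proof. by rewrite (form_of_dualE U (test_DL1_set u)); congr U;
  exact: val_inj. Qed.

Lemma DL1_normE m (w : DL1 R) : DL1_norm m w = (sobolev m w)%:E.
Proof.
have dw : DL1_set (w : R -> R[i]) by have := DL1_prop w; rewrite unfold_in inE.
rewrite /DL1_norm /sobolev -sumEFin; apply: eq_bigr => i _.
by rewrite L1normE//; exact: DL1_cL1.
Qed.

Lemma cmod_real (t : R) : cmod t%:C = `|t|.
Proof.
by rewrite /cmod /Num.norm/= expr0n addr0 sqrtr_sqr.
Qed.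

Lemma sobolevZ m (a : R[i]) f : DL1_set f ->
  sobolev m (a *: f) = cmod a * sobolev m f.
Proof.
move=> df; rewrite /sobolev mulr_sumr; apply: eq_bigr => i _.
by rewrite cderivnZ ?l1Z//; [exact: DL1_cL1|case: df].
Qed.

Lemma bounded_form_of_dual U : DL1_dual U ->
  exists m, bounded_form m (form_of_dual U).
Proof.
move=> [lU cU].
have lV (a : R[i]) f g : DL1_set f -> DL1_set g ->
    form_of_dual U (a *: f + g) = a * form_of_dual U f + form_of_dual U g.
  move=> df dg; rewrite (form_of_dualE U df) (form_of_dualE U dg).
  rewrite (form_of_dualE U (DL1_lin a df dg)).
  rewrite -[RHS]lU; congr U; exact: val_inj.
have [m [d d0 Ud]] := cU 0 I 1 ltr01; exists m; split => //.
have U0 : U 0 = 0.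
  have /eqP := lU 1 0 0; rewrite scale1r addr0 mul1r eq_sym -subr_eq0 addrK.
  by move/eqP.
exists (2 / d); first by rewrite divr_ge0// ltW.
move=> f df; set N := sobolev m f; have N0 : 0 <= N by exact: sobolev_ge0.
apply/ler_addgt0Pr => e e0.
(* Continuity at 0 is applied to [t] times f, whose norm is below [d]. Adding [eps] to the norm
   covers functions of norm 0, and its value makes 1/t equal to (2/d) N + e. *)
pose eps := e * d / 2; have eps0 : 0 < eps by rewrite divr_gt0// mulr_gt0.
pose t := d / 2 / (N + eps).
have Ne : 0 < N + eps by rewrite ltr_wpDl.
have t0 : 0 < t by rewrite divr_gt0// divr_gt0.
have dtf := DL1Z t%:C df.
have /= := Ud (MkDL1 (mem_in_DL1 dtf)) I.
rewrite subr0 U0 subr0 DL1_normE/= sobolevZ// cmod_real gtr0_norm// lte_fin.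
have -> : t * sobolev m f < d.
  rewrite -/N /t mulrAC ltr_pdivrMr// mulrAC.
  rewrite ltr_pdivrMr// -mulrA ltr_pM2l//.
  lra.
move=> /(_ isT); rewrite -(form_of_dualE U dtf).
have -> : form_of_dual U (t%:C *: f) = t%:C * form_of_dual U f.
  have := lV t%:C f 0 df (DL1_0 R); rewrite addr0 => ->.
  rewrite (form_of_dualE U (DL1_0 R)).
  rewrite (_ : MkDL1 _ = 0) ?U0 ?addr0//; exact: val_inj.
rewrite -[`|_|]/(cmod (t%:C * form_of_dual U f)) cmodM cmod_real gtr0_norm//.
move=> /ltW; rewrite -ler_pdivlMl// mulr1 => /le_trans; apply.
rewrite le_eqVlt; apply/orP; left; apply/eqP.
by rewrite /t invf_div /eps; field; rewrite gt_eqF.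
Qed.

End forms_of_dual.

(** * Almost automorphic functions *)
Section almost_automorphic_theory.
Variable R : realType.
Implicit Types (f g : R -> R[i]) (k : nat -> nat).

Lemma subsequence_comp k k' : subsequence k -> subsequence k' ->
  subsequence (k \o k').
Proof. by move=> kS k'S m n mn; exact/kS/k'S. Qed.

Lemma subsequence_ge k : subsequence k -> forall n, (n <= k n)%N.
Proof.
move=> kS; elim=> // n IH; exact: leq_ltn_trans IH (kS _ _ (ltnSn n)).
Qed.

Lemma subsequence_cvg k : subsequence k -> k n @[n --> \oo] --> \oo.
Proof.
move=> kS; apply/cvgnyPge => A; exists A => // n /= An.
exact: leq_trans An (subsequence_ge kS n).
Qed.

Lemma cvg_subseq (u : nat -> Rcomplex R) (l : Rcomplex R) k : subsequence k ->
  u @ \oo --> l -> (u \o k) @ \oo --> l.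
Proof. by move=> kS ul; exact: (cvg_comp _ _ (subsequence_cvg kS) ul). Qed.

(** Otherwise |f(s_n)| > n for some sequence s, while along a subsequence f(0 + s_(k n)) converges,
    hence is bounded, although k n >= n. *)
Lemma almost_automorphic_bounded f : almost_automorphic f ->
  exists C, forall x, cmod (f x) <= C.
Proof.
move=> [cf af]; apply/not_existsP => nb.
have /choice[s sn] : forall n : nat, exists x, n%:R < cmod (f x).
  move=> n; apply: contrapT => /forallNP h; apply: (nb n%:R) => x.
  by rewrite leNgt; apply/negP; exact: h.
have [k kS [g fg _]] := af s.
have /cvg_norm cn := fg 0.
have /cvg_seq_bounded[M [_ /(_ (M + 1))]] : cvgn (fun n => `|f (0 + s
  (k n)) : Rcomplex R|).
  by apply/cvg_ex; eexists; exact: cn.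
rewrite ltrDl ltr01 => /(_ isT) bM.
pose n := Num.bound `|M + 1|.
have := bM n I; rewrite /= add0r normr_id => le1.
have := sn (k n); rewrite ltNge => /negP; apply.
apply: (le_trans le1); apply: (@le_trans _ _ n%:R).
  exact: le_trans (ler_norm _) (ltW (archi_boundP (normr_ge0 _))).
by rewrite ler_nat; exact: subsequence_ge.
Qed.

Lemma almost_automorphicZ (a : R[i]) f : almost_automorphic f ->
  almost_automorphic (a *: f).
Proof.
move=> [cf af]; split.
  move=> x; apply: (@continuous_comp _ _ _ (f : R -> Rcomplex R)
    (Rcomplex_mull (a : Rcomplex R))); first exact: cf.
  exact: Rcomplex_mull_continuous.
move=> s; have [k kS [g fg gf]] := af s; exists k => //; exists (a *: g).
  move=> x; apply: (cvg_comp _ _ (fg x)); exact: Rcomplex_mull_continuous.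
move=> x; apply: (cvg_comp _ _ (gf x)); exact: Rcomplex_mull_continuous.
Qed.

(** Cantor's diagonal extraction. From rank n on, [d] takes values of the n-th extraction at indices
    that are no smaller; this is recorded instead of a factorisation because it is all that passing
    to the limit requires. *)
Lemma diagonal_subsequence (P : nat -> (nat -> nat) -> Prop) :
  (forall n k, subsequence k -> exists2 k', subsequence k' & P n (k \o k')) ->
  exists2 d, subsequence d & forall n, exists2 k, P n k &
    forall j, (n <= j)%N -> exists2 i, (j <= i)%N & d j = k i.
Proof.
move=> H; have /choice[F HF] : forall nk : nat * (nat -> nat), exists k',
    subsequence nk.2 -> subsequence k' /\ P nk.1 (nk.2 \o k').
  move=> [n k] /=; have [kS|nk] := pselect (subsequence k).
    by have [k' k'S Pk] := H n k kS; exists k'.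
  (* A junk value: the choice function has to be total, and nothing is promised when k is not a
     subsequence. *)
  by exists id.
pose K := fix K n : nat -> nat :=
  if n is n'.+1 then K n' \o F (n', K n') else id.
have KS n : subsequence (K n).
  elim: n => [//|n IH]; apply: subsequence_comp => //.
  by have [] := HF (n, K n) IH.
have FS n : subsequence (F (n, K n)) by have [] := HF (n, K n) (KS n).
have Kfact n i : exists2 k', subsequence k' & K (n + i)%N = K n \o k'.
  elim: i => [|i [k' k'S IH]]; first by exists id => //; rewrite addn0.
  exists (k' \o F ((n + i)%N, K (n + i)%N)); first exact: subsequence_comp.
  by rewrite addnS /= {1}IH.
exists (fun n => K n.+1 n).
  have dS n : (K n.+1 n < K n.+2 n.+1)%N.
    exact/(KS n.+1)/(leq_trans (ltnSn n))/(subsequence_ge (FS n.+1)).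
  by move=> m n; elim: n => // n IH;
    rewrite ltnS leq_eqVlt => /orP[/eqP-> //|/IH /ltn_trans]; apply.
move=> n; exists (K n.+1) => [|j nj]; first by have [] := HF (n, K n) (KS n).
have [k' k'S E] := Kfact n.+1 (j - n)%N.
by exists (k' j); [exact: subsequence_ge|rewrite -[j in K j.+1](subnKC nj)
  -addSn E].
Qed.

Lemma cvg_diagonal (u : nat -> Rcomplex R) (l : Rcomplex R) k d n :
  (forall j, (n <= j)%N -> exists2 i, (j <= i)%N & d j = k i) ->
  (u \o k) @ \oo --> l -> (u \o d) @ \oo --> l.
Proof.
move=> dk /cvgrPdist_lt ul; apply/cvgrPdist_lt => e e0.
have [N _ NP] := ul e e0; exists (maxn n N) => // j /=;
  rewrite geq_max => /andP[nj Nj].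
by have [i ji ->] := dk j nj; apply: NP; exact: leq_trans Nj ji.
Qed.

Lemma cmodB (a b : R[i]) : cmod (a - b) = cmod (b - a).
Proof. exact: (@distrC _ (Rcomplex R)). Qed.

Lemma cmodD (a b : R[i]) : cmod (a + b) <= cmod a + cmod b.
Proof. exact: (@ler_normD _ (Rcomplex R)). Qed.

Lemma cmod_dist (b a c : R[i]) : cmod (a - c) <= cmod (a - b) + cmod (b - c).
Proof. exact: (@ler_distD _ (Rcomplex R)). Qed.

Lemma cmod_cvg_le (u v : nat -> Rcomplex R) (l l' : Rcomplex R) (c : R) :
  u @ \oo --> l -> v @ \oo --> l' -> (forall t, cmod (u t - v t) <= c) ->
  cmod (l - l') <= c.
Proof.
move=> ul vl uv; have h : `|u t - v t| @[t --> \oo] --> `|l - l'|.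
  by apply: cvg_norm; exact: cvgB.
have hc : (fun=> c) @ \oo --> c by exact: cvg_cst.
by apply: (ler_cvg_to h hc); apply: nearW => t; exact: uv.
Qed.

(** The Cauchy bound is a sum of separate rates so that letting m grow leaves exactly [e n] as the
    distance to the limit. *)
Lemma complex_cauchy_limit (u : nat -> Rcomplex R) (e : nat -> R) :
  e @ \oo --> (0 : R) ->
  (forall n m, cmod (u n - u m) <= e n + e m) ->
  exists2 l : Rcomplex R, u @ \oo --> l & forall n, cmod (u n - l) <= e n.
Proof.
move=> e0 ue.
have cau (r : nat -> R) : (forall n m, `|r n - r m| <= e n + e m) ->
    exists l : R, r @ \oo --> l.
  move=> re; suff : cvgn r by case/cvg_ex => l rl; exists l.
  apply/cauchy_cvgP/cauchy_exP => eps eps0.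
  have /cvgr_lt/(_ (eps / 2)) := e0; rewrite divr_gt0// => /(_ isT)[N _ NP].
  exists (r N), N => // n Nn; rewrite /ball/=.
  apply: (le_lt_trans (re _ _)); rewrite [ltRHS]splitr ltrD//; last exact: NP.
  by apply: NP => /=.
have [|a ra] := cau (fun n => complex.Re (u n)).
  move=> n m; apply: le_trans (ue n m).
  by rewrite -ReN -ReD; exact: ler_Re.
have [|b rb] := cau (fun n => complex.Im (u n)).
  move=> n m; apply: le_trans (ue n m).
  by rewrite -ImN -ImD; exact: ler_Im.
have ul : u @ \oo --> (a +i* b : Rcomplex R) by apply/ccvgP.
exists (a +i* b) => // n.
have h : `|u n - u m| @[m --> \oo] --> `|u n - (a +i* b : Rcomplex R)|.
  by apply: cvg_norm; apply: cvgB => //; exact: cvg_cst.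
have h' : e n + e m @[m --> \oo] --> e n.
  by rewrite -[X in _ --> X]addr0; apply: cvgD => //; exact: cvg_cst.
exact: (ler_cvg_to h h' (nearW _ (ue n))).
Qed.

(** The three-epsilon argument. A general filter lets it serve both for continuity at a point and
    for limits along a sequence of translations. *)
Lemma cvg_uniform_approx (T : Type) (F : set_system T) (FF : Filter F)
    (u : T -> Rcomplex R) (l : Rcomplex R) (u_ : nat -> T -> Rcomplex R)
    (l_ : nat -> Rcomplex R) (e : nat -> R) : e @ \oo --> (0 : R) ->
  (forall n t, cmod (u_ n t - u t) <= e n) ->
    (forall n, cmod (l_ n - l) <= e n) ->
  (forall n, u_ n @ F --> l_ n) -> u @ F --> l.
Proof.
move=> e0 uu ll ul; apply/cvgrPdist_lt => eps eps0.
have eps3 : 0 < eps / 3 by rewrite divr_gt0.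
have /cvgr_lt/(_ (eps / 3) eps3)[N _ NP] := e0.
have eN : e N < eps / 3 by apply: NP => /=.
have /cvgrPdist_lt/(_ (eps / 3) eps3) := ul N.
apply: filterS => t h; rewrite -[`|_|]/(cmod (l - u t)).
apply: (le_lt_trans (cmod_dist (l_ N) _ _)).
have h1 := ll N; rewrite cmodB in h1.
have h2 := le_lt_trans (cmod_dist (u_ N t) (l_ N) (u t))
   (ltr_leD h (uu N t)).
have h3 : cmod (l_ N - u t) <= eps / 3 + e N by apply: ltW.
apply: (le_lt_trans (lerD h1 (ltW h2))); lra.
Qed.

(** A diagonal subsequence works for all the f_n at once. The bound |f_n - f_m| <= e_n + e_m passes
    to the limits g_n of the translates, so these converge uniformly to some g, and uniformity
    allows the limits to be exchanged in both directions. *)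
Lemma almost_automorphic_uniform (f_ : nat -> R -> R[i]) f (e : nat -> R) :
  e @ \oo --> (0 : R) -> (forall n, almost_automorphic (f_ n)) ->
  (forall n x, cmod (f_ n x - f x) <= e n) -> almost_automorphic f.
Proof.
move=> e0 aaf ff; split.
  move=> x; apply: (@cvg_uniform_approx _ _ _ (f : R ->
    Rcomplex R) (f x) f_ (f_^~ x) e e0) => // n.
  by have [cfn _] := aaf n; exact: cfn.
move=> s; pose P n k := exists2 g : R -> R[i],
    forall x, (f_ n (x + s (k j)) : Rcomplex R) @[j --> \oo] -->
      (g x : Rcomplex R) &
    forall x, (g (x - s (k j)) : Rcomplex R) @[j --> \oo] -->
      (f_ n x : Rcomplex R).
have [|d dS dP] := @diagonal_subsequence P.
  move=> n k kS; have [_ /(_ (s \o k))[k' k'S [g fg gf]]] := aaf n.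
  by exists k' => //; exists g.
have /choice[g_ Hg] : forall n, exists g : R -> R[i],
    (forall x, (f_ n (x + s (d j)) : Rcomplex R) @[j --> \oo] -->
      (g x : Rcomplex R)) /\
    (forall x, (g (x - s (d j)) : Rcomplex R) @[j --> \oo] -->
      (f_ n x : Rcomplex R)).
  move=> n; have [k [g fg gf] dk] := dP n; exists g; split=> x.
    exact: (@cvg_diagonal (fun j => f_ n (x + s j)) _ k d n dk (fg x)).
  exact: (@cvg_diagonal (fun j => g (x - s j)) _ k d n dk (gf x)).
exists d => //.
have gg n m x : cmod (g_ n x - g_ m x) <= e n + e m.
  apply: (@cmod_cvg_le _ _ _ _ _ ((Hg n).1 x) ((Hg m).1 x)) => j.
  apply: (le_trans (cmod_dist (f (x + s (d j))) _ _)).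
  by rewrite lerD// cmodB.
have /choice[g Hgg] : forall x, exists l : Rcomplex R, forall n, cmod
  (g_ n x - l) <= e n.
  move=> x; have [l _ ?] := complex_cauchy_limit e0 (fun n m => gg n m x).
  by exists l.
exists g => x.
  apply: (@cvg_uniform_approx _ _ _ (fun j => f (x + s (d j)) : Rcomplex R)
    (g x)
    (fun n j => f_ n (x + s (d j))) (g_^~ x) e e0) => //.
  by move=> n; exact: (Hg n).1.
apply: (@cvg_uniform_approx _ _ _ (fun j => g (x - s (d j)) : Rcomplex R) (f x)
  (fun n j => g_ n (x - s (d j))) (f_^~ x) e e0) => //.
by move=> n; exact: (Hg n).2.
Qed.

Lemma almost_automorphic_common n (f : 'I_n -> R -> R[i]) (s : nat -> R) :
  (forall j, almost_automorphic (f j)) ->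
  exists2 k, subsequence k & exists2 g : 'I_n -> R -> R[i],
   forall j x, (f j (x + s (k i)) : Rcomplex R) @[i --> \oo] -->
     (g j x : Rcomplex R) &
   forall j x, (g j (x - s (k i)) : Rcomplex R) @[i --> \oo] -->
     (f j x : Rcomplex R).
Proof.
elim: n f => [|n IH] f aaf.
  by exists id => //; exists (fun _ _ => 0) => -[].
have [k kS [g fg gf]] := IH (fun j => f (lift ord0 j)) (fun j => aaf _).
have [_ /(_ (s \o k))[k' k'S [g0 fg0 gf0]]] := aaf ord0.
exists (k \o k'); first exact: subsequence_comp.
exists (fun j => if unlift ord0 j is Some i then g i else g0) => j x.
  case: unliftP => [i ->|->]; last exact: fg0.
  exact: (cvg_subseq k'S (fg i x)).
case: unliftP => [i ->|->]; last exact: gf0.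
exact: (cvg_subseq k'S (gf i x)).
Qed.

End almost_automorphic_theory.

(** * Density of the test functions *)
Section cutoff.
Variable R : realType.
Notation mu := (@lebesgue_measure R).
Implicit Types (f g v eta : R -> R[i]).

(** The multipliers of D_(L^1): by the Leibniz rule, bounds on all derivatives keep products in
    [DL1_set]. *)
Definition smooth_bounded f := smooth f /\
  forall j, exists C, forall x, cmod (cderivn j f x) <= C.

Lemma smooth_bounded_deriv j f : smooth_bounded f ->
  smooth_bounded (cderivn j f).
Proof.
move=> [sf bf]; split; first exact: smooth_cderivn.
by move=> i; rewrite cderivnD; exact: bf.
Qed.

Lemma smooth_bounded_lin (a : R[i]) f g : smooth_bounded f ->
  smooth_bounded g ->
  smooth_bounded (a *: f + g).
Proof.
move=> [sf bf] [sg bg]; split; first exact: smooth_lin.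
move=> j; have [C fC] := bf j; have [D gD] := bg j.
exists (cmod a * C + D) => x; rewrite cderivn_lin//.
rewrite (le_trans (cmodD (a * cderivn j f x) (cderivn j g x)))// lerD//.
by rewrite cmodM ler_wpM2l// normr_ge0.
Qed.

Lemma smooth_boundedM f g : smooth_bounded f -> smooth_bounded g ->
  smooth_bounded (f \* g).
Proof.
move=> bf bg; split; first by apply: smoothM; [case: bf|case: bg].
move=> j; elim: j f g bf bg => [|j IH] f g bf bg.
  have [_ /(_ 0)[C fC]] := bf; have [_ /(_ 0)[D gD]] := bg.
  exists (C * D) => x; rewrite -[cderivn 0 _ _]/(f x * g x) cmodM.
  by rewrite ler_pM ?normr_ge0.
have [sf _] := bf; have [sg _] := bg.
have [C1 H1] := IH (cderivn 1 f) g (smooth_bounded_deriv 1 bf) bg.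
have [C2 H2] := IH f (cderivn 1 g) bf (smooth_bounded_deriv 1 bg).
exists (C1 + C2) => x; rewrite -addn1 -cderivnD cderivnM1// cderivn_add.
- exact: le_trans (cmodD _ _) (lerD (H1 x) (H2 x)).
- by apply: smoothM => //; exact: smooth_cderivn.
- by apply: smoothM => //; exact: smooth_cderivn.
Qed.

Lemma Rcomplex_scaleE (s : R) (z : R[i]) : s *: (z : Rcomplex R) =
  s%:C * z :> R[i].
Proof. by case: z => a b; apply: complex_ext;
  rewrite /= ?mul0r ?subr0 ?addr0. Qed.

Lemma smooth_bounded_affine (s c : R) f : smooth_bounded f ->
  smooth_bounded (fun y => f (s * y + c)).
Proof.
move=> [sf bf]; split; first exact: smooth_affine.
move=> j; have [C fC] := bf j; exists (`|s ^+ j| * C) => x.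
rewrite cderivn_affine// Rcomplex_scaleE cmodM cmod_real.
by rewrite ler_wpM2l// normr_ge0.
Qed.

Lemma smooth_bounded_cst (a : R[i]) : smooth_bounded (fun=> a).
Proof.
split; first exact: smooth_cst.
case=> [|j]; first by exists (cmod a).
exists 0 => x; rewrite -addn1 -cderivnD (@cderivn1E _ _ 0).
  by rewrite cderivn0 /cmod normr0.
by move=> y; exact: is_cderive_cst.
Qed.

Lemma bounded_compact_support f (M : R) : continuous (f : R -> Rcomplex R) ->
  (forall x, M < `|x| -> f x = 0) -> exists C, forall x, cmod (f x) <= C.
Proof.
move=> /ccontinuousP[c1 c2] fM.
have [|C1 H1] := @bounded_bump R (fun x => complex.Re (f x)) M c1.
  by move=> x /fM ->.
have [|C2 H2] := @bounded_bump R (fun x => complex.Im (f x)) M c2.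
  by move=> x /fM ->.
by exists (C1 + C2) => x; exact: le_trans (cmod_le _) (lerD (H1 x) (H2 x)).
Qed.

Lemma smooth_bounded_compact f (M : R) : smooth f ->
  (forall x, M < `|x| -> f x = 0) -> smooth_bounded f.
Proof.
move=> sf fM; split=> // j; apply: (@bounded_compact_support _ M).
  exact: smooth_continuous.
exact: cderivn_eq0.
Qed.

Lemma ccontinuousM f g : continuous (f : R -> Rcomplex R) ->
  continuous (g : R -> Rcomplex R) -> continuous (f \* g : R -> Rcomplex R).
Proof.
move=> /ccontinuousP[f1 f2] /ccontinuousP[g1 g2]; apply/ccontinuousP; split=> x.
  have -> : (fun x => complex.Re ((f \* g) x)) =
      (fun x => complex.Re (f x)) \* (fun x => complex.Re (g x)) \-
      (fun x => complex.Im (f x)) \* (fun x => complex.Im (g x)).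
    by apply/funext => y /=; case: (f y) (g y) => ? ? [].
  by apply: continuousB; apply: continuousM;
    [exact: f1|exact: g1|exact: f2|exact: g2].
have -> : (fun x => complex.Im ((f \* g) x)) =
    (fun x => complex.Re (f x)) \* (fun x => complex.Im (g x)) \+
    (fun x => complex.Im (f x)) \* (fun x => complex.Re (g x)).
  by apply/funext => y /=; case: (f y) (g y) => ? ? [].
by apply: continuousD; apply: continuousM;
  [exact: f1|exact: g2|exact: f2|exact: g1].
Qed.

Lemma cL1M f g (C : R) : continuous (f : R -> Rcomplex R) ->
  (forall x, cmod (f x) <= C) -> cL1 g ->
  cL1 (f \* g) /\ l1 (f \* g) <= C * l1 g.
Proof.
move=> cf fC g1; have [cg _] := g1.
have [||h hle] := @cL1_dom _ (f \* g) (fun x => C * cabs g x)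
  (ccontinuousM cf cg).
- by apply: integrableRZ; exact: cL1_integrable.
- by move=> x; rewrite cmodM ler_wpM2r ?normr_ge0//.
by split=> //; rewrite (le_trans hle)// RintegralZl//; exact: cL1_integrable.
Qed.

Lemma DL1M f v : smooth_bounded f -> DL1_set v -> DL1_set (f \* v).
Proof.
move=> bf dv; split; first by apply: smoothM; [case: bf|case: dv].
suff H i : cL1 (cderivn i (f \* v)) by move=> i; case: (H i).
elim: i f v bf dv => [|i IH] f v bf dv.
  have [sf /(_ 0)[C fC]] := bf.
  by have [] := cL1M (smooth_continuous (n := 0) sf) fC (DL1_cL1 0 dv).
have [sf _] := bf; have [sv _] := dv.
have sf1 := smooth_cderivn (n := 1) sf; have sv1 := smooth_cderivn (n := 1) sv.
rewrite -addn1 -cderivnD cderivnM1// cderivn_add;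
  [|exact: smoothM|exact: smoothM].
rewrite -[X in X + _]scale1r; apply: cL1_lin; apply: IH => //.
  exact: smooth_bounded_deriv.
exact: DL1_cderivn.
Qed.

Lemma cderivn1_eq0_near (f : R -> R[i]) : (forall x, `|x| < 1 -> f x = 0) ->
  forall x, `|x| < 1 -> cderivn 1 f x = 0.
Proof.
move=> f0 x x1; rewrite /cderivn/= derive1E.
rewrite (@near_eq_derive _ _ _ _ (cst 0)) ?derive_cst//.
have : open [set y : R | `|y| < 1].
  have := @open_comp R R Num.norm [set y | y < 1]
    (fun x _ => @norm_continuous R R x).
  by apply; exact: open_lt.
by move=> oM; near=> y; apply: f0; near: y; exact: open_nbhs_nbhs.
Unshelve. all: by end_near. Qed.

(* The [+ 0] matches the shape of [cderivn_affine]. *)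
Definition dilate (n : nat) f : R -> R[i] := fun y => f (n.+1%:R^-1 * y + 0).

(** Here [eta] stands for 1 minus a cutoff. Without derivatives, dominated convergence applies, as
    the dilated [eta] vanishes on |x| < n + 1. A derivative that falls on the dilated factor brings
    out 1/(n + 1) <= 1 and replaces [eta] by its derivative, which also vanishes near 0: the
    induction therefore runs over all [eta] and [v]. *)
Lemma l1_dilate_cvg0 i eta v : smooth_bounded eta ->
  (forall x, `|x| < 1 -> eta x = 0) -> DL1_set v ->
  l1 (cderivn i (dilate n eta \* v)) @[n --> \oo] --> (0 : R).
Proof.
elim: i eta v => [|i IH] eta v beta eta0 dv.
  have [seta /(_ 0)[C etaC]] := beta.
  have -> : 0 = \int[mu]_x (fun=> 0 : R) x by rewrite /Rintegral integral0.
  have ceta n : continuous (dilate n eta : R -> Rcomplex R).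
    by apply: (@smooth_continuous _ _ 0); exact: smooth_affine.
  have cv : continuous (v : R -> Rcomplex R).
    by apply: (@smooth_continuous _ _ 0); case: dv.
  apply: (@Rintegral_dct _ _ _ (fun x => C * cabs v x)).
  - move=> n; apply/measurable_EFinP; apply: cabs_measurable.
    exact: ccontinuousM.
  - move=> x; apply: cvg_near_cst; near=> n.
    rewrite /cabs /= /dilate eta0 ?mul0r ?normr0//.
    rewrite addr0 normrM ger0_norm ?invr_ge0//.
    rewrite mulrC ltr_pdivrMr ?ltr0n// mul1r.
    apply: (lt_trans (archi_boundP (normr_ge0 x))); rewrite ltr_nat ltnS.
    by near: n; exact: nbhs_infty_ge.
  - by apply: integrableRZ; exact/cL1_integrable/(DL1_cL1 0 dv).
  - move=> n x; rewrite ger0_norm ?cabs_ge0//.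
    rewrite -[leLHS]/(cmod (dilate n eta x * v x)) cmodM ler_wpM2r ?normr_ge0//.
    exact: etaC.
have [seta _] := beta; have [sv _] := dv.
have b1 := smooth_bounded_deriv 1 beta.
have dv1 := DL1_cderivn 1 dv.
have bdil n g : smooth_bounded g -> smooth_bounded (dilate n g).
  exact: smooth_bounded_affine.
have E n : cderivn i.+1 (dilate n eta \* v) =
    (n.+1%:R^-1)%:C *: cderivn i (dilate n (cderivn 1 eta) \* v) +
    cderivn i (dilate n eta \* cderivn 1 v).
  rewrite -addn1 -cderivnD cderivnM1//; last exact: smooth_affine.
  rewrite /dilate cderivn_affine// -cderivn_lin.
  - congr cderivn; apply/funext => x; congr (_ + _).
    by rewrite expr1 /= Rcomplex_scaleE -mulrA.
  - by have [] := DL1M (bdil n _ b1) dv.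
  - by have [] := DL1M (bdil n _ beta) dv1.
have h1 := IH _ _ b1 (cderivn1_eq0_near eta0) dv.
have h2 := IH _ _ beta eta0 dv1.
have h : l1 (cderivn i (dilate n (cderivn 1 eta) \* v)) +
    l1 (cderivn i (dilate n eta \* cderivn 1 v)) @[n --> \oo] --> (0 : R).
  by rewrite -[X in _ --> X]addr0; exact: cvgD.
apply: (squeeze_cvgr _ (cvg_cst 0) h); apply: nearW => n.
rewrite l1_ge0 E/=.
have d1 := DL1_cL1 i (DL1M (bdil n _ b1) dv).
have d2 := DL1_cL1 i (DL1M (bdil n _ beta) dv1).
rewrite (le_trans (l1_lin _ d1 d2))// lerD2r ler_piMl ?l1_ge0//.
by rewrite cmod_real ger0_norm ?invr_ge0// invf_le1 ?ler1n.
Unshelve. all: by end_near. Qed.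

Lemma test_density v : DL1_set v ->
  exists u : nat -> testfun R,
    forall m, sobolev m (v - u n) @[n --> \oo] --> (0 : R).
Proof.
move=> dv; have [theta [rho [st sr dt t01 [t0 t1 r0 r1]]]] :=
  smooth_step_exists R.
have bt : smooth_bounded (fun x => (theta x)%:C).
  split=> // -[|j].
    by exists 1 => x; rewrite /cderivn/= cmod_real; have /andP[? ?] := t01 x;
      rewrite ger0_norm.
  have -> : cderivn j.+1 (fun x => (theta x)%:C) =
    cderivn j (fun x => (rho x)%:C).
    rewrite -addn1 -cderivnD (@cderivn1E _ _ (fun x => (rho x)%:C))// => x.
    exact: is_cderive_real.
  have [|_] := @smooth_bounded_compact (fun x => (rho x)%:C) 1 sr;
    last by apply.
  move=> x; case: (leP 0 x) => [x0|/ltW/r0->//].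
  by rewrite ger0_norm// => /ltW/r1->.
(* A plateau equal to 1 for |x| < 1 and to 0 for |x| > 2, made of two opposite steps; its error
   factor 1 - chi is [eta] below. *)
pose chi : R -> R[i] := (fun x => (theta (-1 * x + 2))%:C) \* (fun x =>
  (theta (1 * x + 2))%:C).
have bchi : smooth_bounded chi.
  by apply: smooth_boundedM; exact: (smooth_bounded_affine _ _ bt).
have chi1 x : `|x| < 1 -> chi x = 1.
  move=> x1; rewrite /chi/= !t1 ?mulr1//.
    by rewrite mul1r; move: x1; rewrite ltr_norml => /andP[? ?]; lra.
  by rewrite mulN1r; move: x1; rewrite ltr_norml => /andP[? ?]; lra.
have chi0 x : 2 < `|x| -> chi x = 0.
  move=> x2; rewrite /chi/=; have [x0|x0] := leP 0 x.
    by rewrite t0 ?mul0r// mulN1r; move: x2; rewrite ger0_norm// => ?; lra.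
  by rewrite [X in _ * X%:C]t0 ?mulr0// mul1r; move: x2;
    rewrite ltr0_norm// => ?; lra.
pose eta : R -> R[i] := (-1) *: chi + (fun=> 1).
have beta : smooth_bounded eta.
  by apply: smooth_bounded_lin => //; exact: smooth_bounded_cst.
have eta0 x : `|x| < 1 -> eta x = 0.
  move=> x1; rewrite -[LHS]/(-1 * chi x + 1) chi1//.
  by rewrite mulr1 addNr.
have ut n : (dilate n chi \* v) \in @in_test R.
  rewrite unfold_in inE; split.
    by apply: smoothM; [apply: smooth_affine; case: bchi|case: dv].
  apply/compact_suppP; exists (2 * n.+1%:R) => x xn.
  rewrite /= /dilate chi0 ?mul0r// addr0 normrM ger0_norm ?invr_ge0//.
  by rewrite mulrC ltr_pdivlMr.
exists (fun n => Testfun (ut n)) => m.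
have E n : v - Testfun (ut n) = dilate n eta \* v.
  apply/funext => x.
  rewrite -[LHS]/(v x - dilate n chi x * v x).
  rewrite -[RHS]/((-1 * dilate n chi x + 1) * v x).
  by rewrite mulrDl mul1r mulN1r mulNr addrC.
have -> : (fun n => sobolev m (v - Testfun (ut n))) =
    (fun n => \sum_(i < m.+1) l1 (cderivn i (dilate n eta \* v))).
  by apply/funext => n; rewrite E.
elim: m.+1 => [|k IH].
  by under eq_fun do rewrite big_ord0; exact: cvg_cst.
under eq_fun do rewrite big_ord_recr /=.
have h : \sum_(i < k) l1 (cderivn i (dilate n eta \* v)) +
    l1 (cderivn k (dilate n eta \* v)) @[n --> \oo] --> (0 + 0 : R).
  by apply: cvgD => //; exact: l1_dilate_cvg0.
by move: h; rewrite addr0.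
Qed.

Definition aa_form (V : (R -> R[i]) -> R[i]) := forall phi, DL1_set phi ->
  almost_automorphic (fun x => V (fun y => phi (x - y))).

(** The approximation is uniform in x because [sobolev] is invariant under the reflections y |-> x -
    y. *)
Lemma aa_form_of_test m V : bounded_form m V ->
  (forall u : testfun R, almost_automorphic (fun x => V (fun y => u
    (x - y)))) ->
  aa_form V.
Proof.
move=> bV aaV phi dphi; have [u uphi] := test_density dphi.
have [lV [C C0 VC]] := bV.
apply: (@almost_automorphic_uniform _ (fun n x => V (fun y => u n (x - y))) _
  (fun n => C * sobolev m (phi - u n))).
- by rewrite -[X in _ --> X](mulr0 C); apply: cvgM;
  [exact: cvg_cst|exact: uphi].
- by move=> n; exact: aaV.
- move=> n x; have du := test_DL1_set (u n).
  have dB := DL1B dphi du.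
  rewrite cmodB -(bounded_formB bV); [|exact: DL1_reflect|exact: DL1_reflect].
  rewrite (le_trans (VC _ (DL1_reflect x dB)))//.
  by rewrite sobolev_reflect.
Qed.

Lemma aa_form_resolvent V : aa_form V -> aa_form (V \o @resolvent R).
Proof.
move=> aaV phi dphi.
have dr := DL1_reflect 0 dphi; have [dJ _ _] := DL1_resolvent dr.
have := aaV _ (DL1_reflect 0 dJ); congr almost_automorphic.
by apply/funext => x /=; rewrite [in RHS](resolvent_reflect x dphi).
Qed.

End cutoff.

(** * Forms of order 0 *)
Section order_zero.
Variable R : realType.
Notation mu := (@lebesgue_measure R).
Implicit Types (f g v : R -> R[i]).

Lemma derive_lipschitz (g dg : R -> R) (K : R) :
  (forall x : R, is_derive x 1 g (dg x)) -> (forall x, `|dg x| <= K) ->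
  forall a b, `|g b - g a| <= K * `|b - a|.
Proof.
move=> dG dK; have H a b : a < b -> `|g b - g a| <= K * `|b - a|.
  move=> ab; have [|c _ ->] := @MVT R g dg a b ab (fun x _ => dG x).
    exact/continuous_subspaceT/is_derive_continuous.
  by rewrite normrM ler_wpM2r.
move=> a b; have [ab|ba|->] := ltgtP a b; first exact: H.
  by rewrite distrC [`|b - a|]distrC; exact: H.
by rewrite !subrr normr0 mulr0.
Qed.

(** The mean value theorem for g, then the Lipschitz bound for its derivative; this gives K instead
    of the sharp K/2. *)
Lemma taylor2 (g dg ddg : R -> R) (K : R) :
  (forall x : R, is_derive x 1 g (dg x)) ->
  (forall x : R, is_derive x 1 dg (ddg x)) -> (forall x, `|ddg x| <= K) ->
  forall a k, `|g (a + k) - g a - k * dg a| <= K * k ^+ 2.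
Proof.
move=> dG ddG dK a k.
have [b [ba E]] : exists b, `|b - a| <= `|k| /\ g (a + k) - g a = dg b * k.
  have [k0|k0|->] := ltgtP k 0.
  - have ak : a + k < a by rewrite gtrDl.
    have [|c /[!in_itv]/= /andP[c1 c2] E] :=
      @MVT R g dg _ _ ak (fun x _ => dG x).
      exact/continuous_subspaceT/is_derive_continuous.
    exists c; split; first by rewrite !ltr0_norm//; lra.
    by rewrite -opprB E; ring.
  - have ak : a < a + k by rewrite ltrDl.
    have [|c /[!in_itv]/= /andP[c1 c2] E] :=
      @MVT R g dg _ _ ak (fun x _ => dG x).
      exact/continuous_subspaceT/is_derive_continuous.
    exists c; split; first by rewrite !gtr0_norm//; lra.
    by rewrite E; ring.
  - by exists a; rewrite subrr addr0 subrr mulr0.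
rewrite E [k * _]mulrC -mulrBl normrM.
have := derive_lipschitz ddG dK a b => H.
have K0 : 0 <= K := le_trans (normr_ge0 _) (dK 0).
rewrite -(ger0_norm (sqr_ge0 k)) normrX expr2 mulrA ler_wpM2r//.
by rewrite (le_trans H)// ler_wpM2l.
Qed.

(** The mean value equality fails for complex values, so the two parts are estimated separately, at
    the price of a factor 2. *)
Lemma cderive_lipschitz g (K : R) : smooth g ->
  (forall x, cmod (cderivn 1 g x) <= K) ->
  forall a b, cmod (g b - g a) <= (K *+ 2) * `|b - a|.
Proof.
move=> sg gK a b; apply: (le_trans (cmod_le _)).
have d x := (cis_derivP g x _).1 (@smooth_is_cderive _ g 0 x sg).
rewrite mulr2n mulrDl ReD ImD ReN ImN; apply: lerD.
  apply: (derive_lipschitz (fun x => (d x).1)) => x.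
  exact: le_trans (ler_Re _) (gK x).
apply: (derive_lipschitz (fun x => (d x).2)) => x.
exact: le_trans (ler_Im _) (gK x).
Qed.

Lemma l1_bump f (a b c : R) : continuous (f : R -> Rcomplex R) -> a <= b ->
  (forall x, cmod (f x) <= c) -> (forall x, x < a -> f x = 0) ->
  (forall x, b < x -> f x = 0) -> cL1 f /\ l1 f <= c * (b - a).
Proof.
move=> cf ab fc fa fb.
have mf : measurable_fun [set: R] (cabs f).
  exact: continuous_measurable_fun (cabs_continuous cf).
have [|||i le] := integrable_bump mf ab (c := c).
- by move=> x; rewrite ger0_norm ?cabs_ge0//; exact: fc.
- by move=> x xa; rewrite /cabs fa// normr0.
- by move=> x xb; rewrite /cabs fb// normr0.
have [|h hle] := cL1_dom cf i; first by [].
split=> //; apply: le_trans le; apply: le_Rintegral => //.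
  exact: integrable_norm.
by move=> x _; exact: ler_norm.
Qed.

(** Subtracting from F_n a primitive of k leaves a function with Lipschitz constant D/(n + 1), whose
    increment over [-A, A] is w minus the integral of k, independently of n. *)
Lemma FTC_limit (F dF : nat -> R -> R) (k : R -> R) (A D w : R) :
  continuous k -> mu.-integrable [set: R] (EFin \o k) -> 0 < A ->
  (forall x, A <= `|x| -> k x = 0) ->
  (forall n (t : R), is_derive t 1 (F n) (dF n t)) ->
  (forall n t, `|dF n t - k t| <= D / n.+1%:R) ->
  (forall n, F n (- A) = 0) -> (forall n, F n A = w) ->
  w = \int[mu]_x k x.
Proof.
move=> ck ik A0 kA dFF dFk FA0 FA.
pose P (y : R) := \int[mu]_(t in `]-oo, y]) k t.
have dP (t : R) : is_derive t 1 P (k t).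
  by apply: FTC_Ny => // y; apply: integrableS ik.
have PNA : P (- A) = 0.
  rewrite /P; under eq_Rintegral.
    move=> y; rewrite inE/= in_itv/= => yA.
    rewrite kA; last by rewrite -normrN (le_trans _ (ler_norm _))// lerNr.
    over.
  by rewrite /Rintegral /= integral0.
have PA : P A = \int[mu]_x k x.
  rewrite /P Rintegral_mkcond; apply: eq_Rintegral => x _.
  rewrite patchE; case: ifPn => //; rewrite notin_setE/= in_itv/= => /negP.
  by rewrite -ltNge => Ax; rewrite kA// (le_trans (ltW Ax))// ler_norm.
rewrite -PA; apply/eqP; rewrite -subr_eq0 -normr_le0.
apply/ler_addgt0Pr => e e0; rewrite add0r.
have D0 : 0 <= D.
  by have := le_trans (normr_ge0 _) (dFk 0 0); rewrite divr1.
pose n := Num.bound (D * (A + A) / e).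
have := @derive_lipschitz (F n - P) (fun t => dF n t - k t) (D / n.+1%:R) _
  (dFk n) (- A) A.
rewrite -[(F n - P) A]/(F n A - P A) -[(F n - P) (- A)]/(F n (- A) - P (- A)).
rewrite FA FA0 PNA subrr subr0 opprK => H; apply: (le_trans (H _)).
rewrite ger0_norm ?addr_ge0 ?(ltW A0)// mulrAC ler_pdivrMr ?ltr0n//.
rewrite [e * _]mulrC -ler_pdivrMr//.
have : D * (A + A) / e < n%:R.
  by apply: archi_boundP; rewrite divr_ge0 ?mulr_ge0 ?addr_ge0 ?(ltW A0) ?(ltW
    e0).
by move=> /ltW/le_trans; apply; rewrite ler_nat.
Qed.

(** The [th n] tend to the Heaviside function and the [rh n] to the Dirac mass. The last clause
    expresses the derivative by a remainder uniform in z: in this form it survives multiplication by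
    a test function and application of a form of order 0. *)
Lemma smooth_step_sequence : exists (th rh : nat -> R -> R[i]) (M : R),
  [/\ forall n, smooth (th n), forall n, cderivn 1 (th n) = rh n,
      forall n x, x <= 0 -> th n x = 0, forall n x, n.+1%:R^-1 <= x ->
        th n x = 1 &
   [/\ forall n m x, cmod (th n x - th m x) <= 1,
      forall n x, cmod (rh n x) <= n.+1%:R * M &
      forall n, exists2 K, 0 <= K & forall z h,
        cmod (th n (z + h) - th n z - h%:C * rh n z) <= K * h ^+ 2]].
Proof.
have [theta [rho [st sr dt t01 [t0 t1 r0 r1]]]] := smooth_step_exists R.
have rho_out x : 1 < `|x| -> rho x = 0.
  case: (leP 0 x) => [x0|/ltW/r0->//].
  by rewrite ger0_norm// => /ltW/r1->.
have brho : smooth_bounded (fun x => (rho x)%:C).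
  apply: (@smooth_bounded_compact _ _ 1 sr) => x /rho_out ->//.
have [K HK] := (proj2 brho) 1%N; have [M HM] := (proj2 brho) 0%N.
pose drho x := complex.Re (cderivn 1 (fun x => (rho x)%:C) x).
have dr (x : R) : is_derive x 1 rho (drho x).
  by have [] := (cis_derivP _ x _).1 (@smooth_is_cderive _ _ 0 x sr).
have drhoK x : `|drho x| <= K by exact: le_trans (ler_Re _) (HK x).
have K0 : 0 <= K := le_trans (normr_ge0 _) (drhoK 0).
pose nu (n : nat) : R := n.+1%:R.
have nu0 n : 0 < nu n by rewrite ltr0n.
exists (fun n z => (theta (nu n * z + 0))%:C),
  (fun n z => (nu n)%:C * (rho (nu n * z + 0))%:C), M; split; last split.
- by move=> n; exact: (smooth_affine (s := nu n) (c := 0) st).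
- move=> n; apply/funext => x; rewrite (cderivn_affine 1 (nu n) 0 st) expr1.
  rewrite Rcomplex_scaleE (@cderivn1E _ _ (fun x => (rho x)%:C))// => y.
  exact: is_cderive_real.
- by move=> n x x0; rewrite addr0 t0// pmulr_rle0.
- by move=> n x h; rewrite addr0 t1// mulrC -ler_pdivrMr// div1r.
- move=> n m x; rewrite -rmorphB/= cmod_real.
  have /andP[? ?] := t01 (nu n * x + 0); have /andP[? ?] := t01 (nu m * x + 0).
  by rewrite ler_norml; apply/andP; split; lra.
- move=> n x; rewrite cmodM [cmod (nu n)%:C]cmod_real ger0_norm ?(ltW
  (nu0 n))//.
  by rewrite ler_wpM2l ?(ltW (nu0 n))//; exact: HM.
- move=> n; exists (K * nu n ^+ 2); first by rewrite mulr_ge0// sqr_ge0.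
  move=> z h; rewrite !addr0 mulrA -!rmorphM/= -!rmorphB/= cmod_real.
  have := taylor2 dt dr drhoK (nu n * z) (nu n * h).
  by rewrite -mulrDr exprMn mulrA [nu n * h]mulrC.
Qed.

(** * The density of a form of order 0 composed with the resolvent *)

Section representation.
Variables (V : (R -> R[i]) -> R[i]) (th rh : nat -> R -> R[i]) (M : R).
Hypotheses (bV : bounded_form 0 V) (aaV : aa_form V).
Hypotheses (sth : forall n, smooth (th n)) (dth : forall n, cderivn 1 (th n) =
  rh n).
Hypotheses (th0 : forall n x, x <= 0 -> th n x = 0).
Hypotheses (th1 : forall n x, n.+1%:R^-1 <= x -> th n x = 1).
Hypotheses (thB : forall n m x, cmod (th n x - th m x) <= 1).
Hypotheses (rhM : forall n x, cmod (rh n x) <= n.+1%:R * M).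
Hypotheses (th2 : forall n, exists2 K, 0 <= K & forall z h,
        cmod (th n (z + h) - th n z - h%:C * rh n z) <= K * h ^+ 2).

Let nu (n : nat) : R := n.+1%:R.
Let nu0 n : 0 < nu n. Proof. by rewrite ltr0n. Qed.
Let nuV n : 0 < (nu n)^-1. Proof. by rewrite invr_gt0. Qed.
Let nuV1 n : (nu n)^-1 <= 1. Proof. by rewrite invf_le1 ?ler1n. Qed.
(** Two estimates coexist: [W] is bounded by the L^1 norm, which handles the error terms, while the
    bound on [V] is applied after the resolvent and yields the gain in [fn_cauchy]. *)
Let W := V \o @resolvent R.
Let bW : bounded_form 0 W. Proof. exact: bounded_form_resolvent0. Qed.
Let srh n : smooth (rh n). Proof. by rewrite -dth; exact: smooth_cderivn. Qed.

Let rh_lt0 n x : x < 0 -> rh n x = 0.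
Proof.
move=> x0; rewrite -dth /cderivn/= derive1E.
rewrite (@near_eq_derive _ _ _ _ (cst 0)) ?derive_cst//.
by near=> y; apply: th0; apply: ltW; near: y; exact: lt_nbhsl.
Unshelve. all: by end_near. Qed.

Let rh_gtV n x : (nu n)^-1 < x -> rh n x = 0.
Proof.
move=> x0; rewrite -dth /cderivn/= derive1E.
rewrite (@near_eq_derive _ _ _ _ (@cst R (Rcomplex R)
  (1 : R[i]))) ?derive_cst//.
by near=> y; apply: th1; apply: ltW; near: y; exact: lt_nbhsr.
Unshelve. all: by end_near. Qed.

Let DL1_of_compact_support g (A : R) : smooth g -> (forall x, A < `|x| ->
  g x = 0) ->
  DL1_set g.
Proof.
move=> sg gA; have tg : g \in @in_test R.
  by rewrite unfold_in inE; split => //; apply/compact_suppP; exists A.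
exact: (test_DL1_set (Testfun tg)).
Qed.

Let Drh n : DL1_set (rh n).
Proof.
apply: (@DL1_of_compact_support _ (nu n)^-1) => // x.
case: (leP 0 x) => [x0|x0 _]; last exact: rh_lt0.
by rewrite ger0_norm//; exact: rh_gtV.
Qed.

Let sg n m : R -> R[i] := th n - th m.

Let sg_out n m x : (nu n)^-1 + (nu m)^-1 < `|x| -> sg n m x = 0.
Proof.
rewrite -[sg n m x]/(th n x - th m x); case: (leP 0 x) => [x0|/ltW x0 _].
  rewrite ger0_norm// => h; rewrite !th1 ?subrr//; apply/ltW.
    by apply: lt_trans h; rewrite ltrDr.
  by apply: lt_trans h; rewrite ltrDl.
by rewrite !th0// subrr.
Qed.

Let ssg n m : smooth (sg n m). Proof. exact: smoothB. Qed.

Let Dsg n m : DL1_set (sg n m).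
Proof. by apply: (@DL1_of_compact_support _ ((nu n)^-1 + (nu m)^-1)) => //;
  exact: sg_out. Qed.

Let l1sg n m : l1 (sg n m) <= (nu n)^-1 + (nu m)^-1.
Proof.
have [|||||_] := @l1_bump (sg n m) 0 ((nu n)^-1 + (nu m)^-1) 1.
- exact: smooth_continuousW (@ssg n m).
- by rewrite addr_ge0// ltW.
- by move=> x; exact: thB.
- by move=> x x0; rewrite -[sg n m x]/(th n x - th m x) !th0 ?subrr// ltW.
- by move=> x h; apply: sg_out; rewrite (lt_le_trans h)// ler_norm.
- by rewrite mul1r subr0.
Qed.

Let fn n t := W (fun x => rh n (t - x)).

Let fn_cauchy : exists2 C, 0 <= C & forall t n m,
  cmod (fn n t - fn m t) <= C * (nu n)^-1 + C * (nu m)^-1.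
Proof.
(* 5 = 1 + 4: the resolvent of a derivative s' is s minus the resolvent of s, and the latter has L^1
   norm at most 4 times that of s. *)
have [_ [C C0 VC]] := bV; exists (C * 5); first by rewrite mulr_ge0.
move=> t n m; rewrite -(bounded_formB bW);
  [|exact: DL1_reflect|exact: DL1_reflect].
have dsr := DL1_reflect t (Dsg n m).
have [dJ J4 _] := DL1_resolvent dsr.
have -> : (fun x => rh n (t - x)) - (fun x => rh m (t - x)) =
   (-1) *: cderivn 1 (fun x => sg n m (t - x)).
  rewrite (cderivn_reflect 1 t (@ssg n m)) expr1 scalerA mulN1r opprK scale1r.
  by rewrite /sg (cderivn_sub 1 (@sth n) (@sth m)) !dth.
rewrite (bounded_formZ (-1) bW (DL1_cderivn 1 dsr)) cmodM.
have := cmod_sign R 1; rewrite expr1 => ->; rewrite mul1r.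
rewrite /W/= (resolvent_deriv dsr) (le_trans (VC _ (DL1B dsr dJ)))//.
rewrite sobolev0 -mulrDr -mulrA ler_wpM2l//.
have h1 := l1B (DL1_cL1 0 dsr) (DL1_cL1 0 dJ).
have h2 : l1 (fun x => sg n m (t - x)) = l1 (sg n m).
  by rewrite l1_reflect//; exact: smooth_continuousW (@ssg n m).
have h3 := l1sg n m.
apply: (le_trans h1); rewrite h2 in J4.
have L (a b c : R) : b <= 4 * a -> a <= c -> a + b <= 5 * c by move=> *; lra.
by rewrite [cderivn 0 _]/cderivn/= h2; exact: L J4 h3.
Qed.

Let fn_limit : exists f C, [/\ almost_automorphic f, 0 <= C &
  forall n t, cmod (fn n t - f t) <= C * (nu n)^-1].
Proof.
have [C C0 cau] := fn_cauchy.
pose e n : R := C * (nu n)^-1.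
have e0 : e @ \oo --> (0 : R).
  rewrite -[X in _ --> X](mulr0 C); apply: cvgM; first exact: cvg_cst.
  exact: cvg_harmonic.
have /choice[f Hf] : forall t, exists l : Rcomplex R, forall n, cmod
  (fn n t - l) <= e n.
  by move=> t; have [l _ ?] := complex_cauchy_limit e0 (cau t); exists l.
exists f, C; split => //.
apply: (almost_automorphic_uniform e0 (f_ := fn)) => // n.
exact: (aa_form_resolvent aaV).
Qed.

Lemma order_zero_representation_aux :
  exists2 f, almost_automorphic f &
    forall u : testfun R, V (resolvent u) = regular f u.
Proof.
have [f [C [aaf C0 fnf]]] := fn_limit; exists f => // u.
have [_ [CW CW0 WC]] := bW.
have [su /compact_suppP[A uA]] := testfunP u.
wlog A0 : A uA / 0 <= A => [H|].
  apply: (H (Num.max A 0)); last by rewrite le_max lexx orbT.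
  by move=> x; rewrite gt_max => /andP[+ _]; exact: uA.
have du := test_DL1_set u.
have bu := smooth_bounded_compact su uA.
have [L HL] := (proj2 bu) 1%N; have [B HB] := (proj2 bu) 0%N.
have L0 : 0 <= L := le_trans (normr_ge0 _) (HL 0).
have B0 : 0 <= B := le_trans (normr_ge0 _) (HB 0).
have Lu := cderive_lipschitz su HL.
have dprod (g : R -> R[i]) : smooth g -> DL1_set (g \* u).
  by move=> sg'; apply: (@DL1_of_compact_support _ A);
    [exact: smoothM|move=> x xA; rewrite /= uA// mulr0].
have sthr n t : smooth (fun x => th n (t - x)) by exact: smooth_reflect.
have srhr n t : smooth (fun x => rh n (t - x)) by exact: smooth_reflect.
pose Phi n t := W ((fun x => th n (t - x)) \* u).
pose dPhi n t := W ((fun x => rh n (t - x)) \* u).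
(* Differentiation in t under the form: the pointwise remainder K h^2 |u| is integrable, and the L^1
   bound of [W] turns it into a remainder for [Phi]. *)
have Phi2 n : exists2 K, 0 <= K & forall t h,
    cmod (Phi n (t + h) - Phi n t - h%:C * dPhi n t) <= K * h ^+ 2.
  have [K K0 HK] := th2 n.
  exists (CW * (K * l1 u)); first by rewrite !mulr_ge0// l1_ge0.
  move=> t h; pose a := (fun x => th n (t + h - x)) \* u.
  pose b := (fun x => th n (t - x)) \* u.
  pose c := (fun x => rh n (t - x)) \* u.
  have [da db dc] : [/\ DL1_set a, DL1_set b & DL1_set c] by split;
    exact: dprod.
  pose g := a - b - h%:C *: c.
  have dg : DL1_set g by apply: DL1B; [exact: DL1B|exact: DL1Z].
  have -> : Phi n (t + h) - Phi n t - h%:C * dPhi n t = W g.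
    rewrite (bounded_formB bW (DL1B da db) (DL1Z _ dc)).
    by rewrite (bounded_formB bW da db) (bounded_formZ _ bW dc).
  rewrite (le_trans (WC _ dg))// sobolev0 -mulrA ler_wpM2l//.
  have uL1 := DL1_cL1 0 du.
  have [] := @cL1_dom _ g (fun x => K * h ^+ 2 * cabs u x).
  - by apply: smooth_continuousW; case: dg.
  - by apply: integrableRZ; exact: cL1_integrable.
  - move=> x; have -> : g x = (th n ((t - x) + h) - th n
    (t - x) - h%:C * rh n (t - x)) * u x.
      rewrite -[g x]/(th n (t + h - x) * u x - th n (t - x) * u x - h%:C *
        (rh n (t - x) * u x)).
      by rewrite (_ : t + h - x =
        t - x + h) ?[RHS]mulrBl ?mulrBl ?mulrA// addrAC.
    by rewrite cmodM ler_wpM2r ?normr_ge0.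
  - move=> _; rewrite RintegralZl//; last exact: cL1_integrable.
    by rewrite mulrAC.
have M0 : 0 <= M.
  by have := le_trans (normr_ge0 _) (rhM 0 0); rewrite mul1r.
(* First u is frozen at t: [rh n (t - x)] is at most (n + 1) M on an interval of length 1/(n + 1),
   where |u(x) - u(t)| <= 2 L/(n + 1), so the L^1 error is at most 2 M L/(n + 1). Then fn is
   replaced by f, at a cost of B C/(n + 1). *)
have dPhiE n t : cmod (dPhi n t - f t * u t) <= (CW * (M *
  (L *+ 2)) + B * C) / nu n.
  rewrite (le_trans (cmod_dist (fn n t * u t) _ _))// mulrDl; apply: lerD.
    pose a := (fun x => rh n (t - x)) \* u; pose b := fun x => rh n (t - x).
    have [da db] : DL1_set a /\ DL1_set b.
      by split; [exact: dprod|exact: DL1_reflect].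
    pose g := a - u t *: b.
    have dg : DL1_set g by apply: DL1B => //; exact: DL1Z.
    have -> : dPhi n t - fn n t * u t = W g.
      by rewrite (bounded_formB bW da (DL1Z _ db))
        (bounded_formZ _ bW db) mulrC.
    rewrite (le_trans (WC _ dg))// sobolev0 -mulrA ler_wpM2l//.
    have gE x : g x = rh n (t - x) * (u x - u t).
      by rewrite -[g x]/(rh n (t - x) * u x - u t * rh n
        (t - x)) mulrBr [u t * _]mulrC.
    have [|||||_] := @l1_bump g (t - (nu n)^-1) t (M * (L *+ 2)).
    - by apply: smooth_continuousW; case: dg.
    - by rewrite gerBl ltW.
    - move=> x; rewrite gE cmodM; have [h|h] := ltP (t - x) 0.
        by rewrite rh_lt0// /cmod normr0 mul0r mulr_ge0// mulrn_wge0.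
      have [h'|h'] := ltP (nu n)^-1 (t - x).
        by rewrite rh_gtV// /cmod normr0 mul0r mulr_ge0// mulrn_wge0.
      apply: (@le_trans _ _ ((nu n * M) * ((L *+ 2) * (nu n)^-1))).
        apply: ler_pM; rewrite ?normr_ge0//.
        apply: (le_trans (Lu t x)); rewrite ler_wpM2l ?mulrn_wge0//.
        by rewrite distrC ger0_norm.
      by rewrite (mulrC (nu n)) mulrACA mulfV ?mulr1 ?gt_eqF.
    - by move=> x; rewrite ltrBrDr => h;
      rewrite gE rh_gtV ?mul0r// ltrBrDr addrC.
    - by move=> x h; rewrite gE rh_lt0 ?mul0r// subr_lt0.
    - by rewrite opprB addrC subrK.
  rewrite -mulrBl cmodM mulrC -mulrA.
  apply: ler_pM; rewrite ?normr_ge0//; exact: HB.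
(* The margin 1 beyond the support of u is at least the width 1/(n + 1) of every step, so at A + 1
   all the steps equal 1 on the support; at -(A + 1) they vanish there. *)
have PhiN n : Phi n (- (A + 1)) = 0.
  rewrite /Phi (_ : _ \* _ = 0) ?(bounded_form0 bW)//; apply/funext => x /=.
  have [xA|xA] := ltP A `|x|; first by rewrite uA// mulr0.
  rewrite th0 ?mul0r//; move: xA; rewrite ler_norml => /andP[? ?]; lra.
have PhiP n : Phi n (A + 1) = W u.
  rewrite /Phi; congr W; apply/funext => x /=.
  have [xA|xA] := ltP A `|x|; first by rewrite uA// mulr0.
  rewrite th1 ?mul1r// (le_trans (nuV1 n))//.
  by move: xA; rewrite ler_norml => /andP[? ?]; lra.
have [cf _] := aaf.
have cu := smooth_continuousW su.
have cfu := ccontinuousM cf cu.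
have [Bf HBf] := almost_automorphic_bounded aaf.
have [fu1 _] := cL1M cf HBf (DL1_cL1 0 du).
have [i1 i2] := cL1_integrable_parts fu1.
have /ccontinuousP[c1 c2] := cfu.
have fuA x : A + 1 <= `|x| -> f x * u x = 0.
  by move=> xA; rewrite uA ?mulr0// (lt_le_trans _ xA)// ltrDl.
have A1 : 0 < A + 1 by rewrite ltr_wpDl.
rewrite -[V (resolvent u)]/(W u); apply: complex_ext.
- apply: (@FTC_limit (fun n t => complex.Re (Phi n t)) (fun n t => complex.Re
  (dPhi n t))
    _ _ _ _ c1 i1 A1).
  + by move=> x /fuA; rewrite /= => ->.
  + move=> n t; have [K K0 HK] := Phi2 n.
    apply: (@is_derive_quadratic _ _ _ _ K) => h _.
    apply: le_trans (HK t h); apply: le_trans (ler_Re _).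
    rewrite !ReD !ReN le_eqVlt; apply/orP; left; apply/eqP.
    congr (`| _ - _ |); case: (dPhi n t) => a b /=; ring.
  + move=> n t; apply: le_trans (dPhiE n t); apply: le_trans (ler_Re _).
    by rewrite ReD ReN.
  + by move=> n; rewrite PhiN.
  + by move=> n; rewrite PhiP.
- apply: (@FTC_limit (fun n t => complex.Im (Phi n t)) (fun n t => complex.Im
  (dPhi n t))
    _ _ _ _ c2 i2 A1).
  + by move=> x /fuA; rewrite /= => ->.
  + move=> n t; have [K K0 HK] := Phi2 n.
    apply: (@is_derive_quadratic _ _ _ _ K) => h _.
    apply: le_trans (HK t h); apply: le_trans (ler_Im _).
    rewrite !ImD !ImN le_eqVlt; apply/orP; left; apply/eqP.
    congr (`| _ - _ |); case: (dPhi n t) => a b /=; ring.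
  + move=> n t; apply: le_trans (dPhiE n t); apply: le_trans (ler_Im _).
    by rewrite ImD ImN.
  + by move=> n; rewrite PhiN.
  + by move=> n; rewrite PhiP.
Qed.

End representation.

Lemma order_zero_representation (V : (R -> R[i]) -> R[i]) :
  bounded_form 0 V -> aa_form V ->
  exists2 f, almost_automorphic f &
    forall u : testfun R, V (resolvent u) = regular f u.
Proof.
move=> bV aaV.
have [th [rh [M [sth dth th0 th1 [thB rhM th2]]]]] := smooth_step_sequence.
exact: (order_zero_representation_aux bV aaV sth dth th0 th1 thB rhM th2).
Qed.

End order_zero.

(** * The three implications *)
Section implications.
Variable R : realType.
Notation mu := (@lebesgue_measure R).
Implicit Types (f g : R -> R[i]) (u : testfun R).

Lemma testfun_eq (u v : testfun R) : (u : R -> R[i]) = (v : R -> R[i]) -> u = v.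
Proof. by move=> uv; exact: val_inj. Qed.

Lemma deriv_testD i j u : deriv_test i (deriv_test j u) = deriv_test (i + j) u.
Proof. by apply: testfun_eq; exact: cderivnD. Qed.

Lemma form_resolvent_split m (V : (R -> R[i]) -> R[i]) u : bounded_form m V ->
  V u = V (resolvent u) + V (resolvent (deriv_test 1 u)).
Proof.
move=> bV; have du := test_DL1_set u; have du1 := test_DL1_set (deriv_test 1 u).
have [dJ _ _] := DL1_resolvent du; have [dJ1 _ _] := DL1_resolvent du1.
rewrite -(bounded_formD bV)//; congr V.
have E := resolvent_addD du; rewrite -{1}E -[X in resolvent (X + _)]scale1r.
by rewrite resolvent_lin// scale1r.
Qed.

(** One function with scalar coefficients, rather than a family, makes the induction a recursion on
    coefficients. It is Pascal's rule, and the coefficients built are the binomials of (1 +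
    d/dx)^(m+1) acting on the test function. *)
Lemma form_representation m (V : (R -> R[i]) -> R[i]) :
  bounded_form m V -> aa_form V ->
  exists n (c : nat -> R[i]) f, almost_automorphic f /\
    forall u, V u = \sum_(j < n.+1) c j * regular f (deriv_test j u).
Proof.
elim: m V => [|m IH] V bV aaV.
  have [f aaf Vf] := order_zero_representation bV aaV.
  exists 1%N, (fun=> 1), f; split => // u.
  rewrite (form_resolvent_split u bV) !big_ord_recl big_ord0 !mul1r addr0.
  rewrite Vf Vf; congr (regular f _ + _); exact: testfun_eq.
have [n [c [f [aaf Wf]]]] := IH _ (bounded_form_resolvent bV)
  (aa_form_resolvent aaV).
(* The test on [j] cuts [c] off: its values beyond [n] are arbitrary and would enter the longer
   sum. *)
exists n.+1, (fun j => (if (j < n.+1)%N then c j else 0) +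
  (if j is i.+1 then c i else 0)), f.
split => // u.
rewrite (form_resolvent_split u bV) [V (resolvent u)]Wf.
rewrite [V (resolvent (deriv_test 1 u))](Wf (deriv_test 1 u)).
under [RHS]eq_bigr do rewrite mulrDl.
rewrite big_split/=; congr (_ + _).
  rewrite [RHS]big_ord_recr/= ltnn mul0r addr0; apply: eq_bigr => i _.
  by rewrite ltn_ord.
rewrite [RHS]big_ord_recl/= mul0r add0r; apply: eq_bigr => i _.
by rewrite deriv_testD addn1.
Qed.

Lemma regular_bound g (C : R) u : cmeasurable g ->
  (forall x, cmod (g x) <= C) ->
  cintegrable (fun x => g x * u x) /\ cmod (regular g u) <= (C * l1 u) *+ 2.
Proof.
move=> mg gC; have u1 := DL1_cL1 0 (test_DL1_set u).
have mu' : cmeasurable u by apply: continuous_cmeasurable; case: u1.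
have [||i le] := @cintegrable_dom _ (fun x => g x * u x) (fun x => C * cabs u x)
    (cmeasurableM mg mu').
- by apply: integrableRZ; exact: cL1_integrable.
- by move=> x; rewrite cmodM ler_wpM2r ?normr_ge0.
split=> //; apply: (le_trans le); rewrite RintegralZl//.
exact: cL1_integrable.
Qed.

Lemma regular_lin g (C : R) (a : R[i]) u v :
  cmeasurable g -> (forall x, cmod (g x) <= C) ->
  regular g (a *: u + v) = a * regular g u + regular g v.
Proof.
move=> mg gC; have [iu _] := regular_bound u mg gC.
have [iv _] := regular_bound v mg gC.
rewrite /regular -cintegral_lin//; congr cintegral; apply/funext => x.
by rewrite -[(a *: u + v : testfun R) x]/(a * u x + v x) mulrDr mulrCA.
Qed.

Lemma regularZ g (C : R) (a : R[i]) u :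
  cmeasurable g -> (forall x, cmod (g x) <= C) ->
  regular (a *: g) u = a * regular g u.
Proof.
move=> mg gC; have [iu _] := regular_bound u mg gC.
have [i0 _] := regular_bound 0 mg gC.
have R0 : regular g 0 = 0.
  have /eqP := regular_lin 1 0 0 mg gC; rewrite scale1r addr0 mul1r eq_sym.
  by rewrite -subr_eq0 addrK => /eqP.
rewrite -[RHS]addr0 -[in RHS]R0 /regular -cintegral_lin//; congr cintegral.
apply/funext => x; rewrite -[(0 : testfun R) x]/(0 : R[i]) mulr0 addr0.
by rewrite -[(a *: g) x]/(a * g x) mulrA.
Qed.

Lemma aa_cmeasurable f : almost_automorphic f -> cmeasurable f.
Proof. by case=> cf _; exact: continuous_cmeasurable. Qed.

Lemma deriv_test_lin j (a : R[i]) u v :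
  deriv_test j (a *: u + v) = a *: deriv_test j u + deriv_test j v.
Proof.
apply: testfun_eq; have [su _] := testfunP u; have [sv _] := testfunP v.
exact: cderivn_lin.
Qed.

Lemma bounded_distribution_representation (T : testfun R -> R[i]) :
  bounded_distribution T -> (forall u, almost_automorphic (dconv T u)) ->
  exists n (f : 'I_n.+1 -> R -> R[i]), (forall j, almost_automorphic (f j)) /\
    T = \sum_(j < n.+1) dderivn j (regular (f j)).
Proof.
move=> [U dU ->] aaT; have [m bV] := bounded_form_of_dual dU.
have [|n [c [f [aaf Vf]]]] := @form_representation m (form_of_dual U) bV.
  apply: (aa_form_of_test bV) => u; have := aaT u; congr almost_automorphic.
  by apply/funext => x; apply/esym;
    exact: (form_of_dual_test U (reflect_test x u)).
(* The sign cancels the one in the definition of distributional derivatives. *)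
exists n, (fun j => ((-1) ^+ j * c j) *: f); split.
  by move=> j; exact: almost_automorphicZ.
apply/funext => u; rewrite /= -form_of_dual_test Vf fct_sumE.
have [C fC] := almost_automorphic_bounded aaf.
apply: eq_bigr => j _; rewrite /dderivn (regularZ _ _ (aa_cmeasurable aaf) fC).
by rewrite !mulrA -expr2 sqrr_sign mul1r.
Qed.

Lemma supnorm_le f x (d : R) : (supnorm f < d%:E)%E -> cmod (f x) <= d.
Proof.
move=> fd; rewrite -lee_fin (le_trans _ (ltW fd))//.
by apply: ereal_sup_ubound; exists x.
Qed.

Lemma test_norm_supnorm n j u (d : R) : (j <= n)%N ->
  (test_norm n u < d%:E)%E ->
  (supnorm (cderivn j u) < d%:E)%E.
Proof.
move=> jn; apply: le_lt_trans; rewrite /test_norm (bigD1 (Ordinal (jn :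
  (j < n.+1)%N)))//=.
rewrite leeDl//; apply: sume_ge0 => i _.
apply: (@le_trans _ _ (cabs (cderivn i u) 0)%:E);
  first by rewrite lee_fin cabs_ge0.
by apply: ereal_sup_ubound; exists 0.
Qed.

(** Used for the limit of the translates, whose densities are only known to be bounded and
    measurable. *)
Lemma regular_sum_distribution n (g : 'I_n.+1 -> R -> R[i]) (C : 'I_n.+1 -> R) :
  (forall j, cmeasurable (g j)) -> (forall j x, cmod (g j x) <= C j) ->
  is_distribution (\sum_(j < n.+1) dderivn j (regular (g j))).
Proof.
move=> mg gC; set S := (X in is_distribution X).
have lS : scalar S.
  move=> a u v; rewrite /S !fct_sumE mulr_sumr -big_split/=.
  apply: eq_bigr => j _; rewrite /dderivn deriv_test_lin.
  by rewrite (regular_lin _ _ _ (mg j) (gC j)) mulrDr mulrCA.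
split=> // K cK v vK e e0; exists n.
have [M0 [_ KM]] := compact_bounded cK.
pose M := `|M0| + 1; have {}KM x : K x -> `|x| <= M.
  by apply: KM; rewrite /M (le_lt_trans (ler_norm _))// ltrDl.
have M1 : 0 <= M by rewrite addr_ge0.
have C0 j : 0 <= C j := le_trans (normr_ge0 _) (gC j 0).
(* On functions supported in [-M, M], the L^1 norm of the j-th derivative is at most 2 M times its
   supremum; the outer factor 2 is the one of [regular_bound]. *)
pose D := \sum_(j < n.+1) (C j * (M + M)) *+ 2.
have D0 : 0 <= D by apply: sumr_ge0 => j _;
  rewrite mulrn_wge0// mulr_ge0// addr_ge0.
exists (e / (D + 1)); first by rewrite divr_gt0// ltr_wpDl.
set d := e / (D + 1) => w wK wd.
have -> : S w - S v = S (w - v).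
  have -> : w - v = (-1) *: v + w by rewrite scaleN1r addrC.
  by rewrite lS mulN1r addrC.
apply: (@le_lt_trans _ _ (D * d)); last first.
  by rewrite /d mulrA ltr_pdivrMr ?ltr_wpDl// mulrC ltr_pM2l// ltrDl.
rewrite -[`|_|]/(cmod (S (w - v))) /S fct_sumE.
have sumle (F : 'I_n.+1 -> R[i]) : cmod
  (\sum_(j < n.+1) F j) <= \sum_(j < n.+1) cmod (F j).
  exact: (@ler_norm_sum _ (Rcomplex R)).
rewrite (le_trans (sumle _))// /D mulr_suml; apply: ler_sum => j _.
rewrite /dderivn cmodM cmod_sign mul1r.
have [_ le] := regular_bound (deriv_test j (w - v)) (mg j) (gC j).
rewrite (le_trans le)// mulrnAl lerMn2r/= -mulrA ler_wpM2l//.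
have z0 x : M < `|x| -> (w - v : testfun R) x = 0.
  move=> xM; have out (t : testfun R) : supp t `<=` K -> t x = 0.
    move=> tK; apply: contrapT => /eqP tx.
    have := KM x (tK x (@subset_closure _ [set z | t z != 0] x tx)).
    by rewrite leNgt xM.
  by rewrite -[LHS]/(w x - v x) (out w wK) (out v vK) subrr.
have [|||||_] := @l1_bump _ (deriv_test j (w - v)) (- M) M d.
- by apply: smooth_continuousW; have [] := testfunP (deriv_test j (w - v)).
- by rewrite ge0_cp.
- move=> x; apply: supnorm_le; apply: test_norm_supnorm wd.
  by rewrite -ltnS ltn_ord.
- move=> x xM; apply: (cderivn_eq0 _ z0).
  by rewrite -normrN (lt_le_trans _ (ler_norm _))// ltrNr.
- by move=> x xM; apply: (cderivn_eq0 _ z0);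
  rewrite (lt_le_trans xM)// ler_norm.
- by rewrite opprK mulrC.
Qed.

Lemma cderivn_shift j (h : R) f : smooth f ->
  cderivn j (fun x => f (x + h)) = fun x => cderivn j f (x + h).
Proof.
move=> sf; have E : (fun x => f (x + h)) = (fun x => f (1 * x + h)).
  by apply/funext => x; rewrite mul1r.
rewrite E cderivn_affine//; apply/funext => x.
by rewrite expr1n scale1r mul1r.
Qed.

Lemma regular_shift j (h : R) g u : cmeasurable g ->
  regular g (deriv_test j (shift_test (- h) u)) =
  cintegral (fun x => g (x + h) * cderivn j u x).
Proof.
move=> mg; have [su _] := testfunP u;
  have [su' _] := testfunP (deriv_test j (shift_test (- h) u)).
rewrite /regular -(@cintegral_shift _ h); last first.
  by apply: cmeasurableM => //; exact/continuous_cmeasurable/smooth_continuousW.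
congr cintegral; apply/funext => x /=.
by rewrite (cderivn_shift j (- h) su) addrK.
Qed.

(** Once the translation is moved from the test function to g, the integrands are dominated by C
    |u^(j)|, independently of n. *)
Lemma regular_shift_cvg j (h : nat -> R) g g' (C : R) u :
  cmeasurable g -> (forall x, cmod (g x) <= C) ->
  (forall x, (g (x + h n) : Rcomplex R) @[n --> \oo] --> (g' x : Rcomplex R)) ->
  (regular g (deriv_test j (shift_test (- h n) u)) : Rcomplex R) @[n --> \oo]
    --> (regular g' (deriv_test j u) : Rcomplex R).
Proof.
move=> mg gC gg'.
have u1 := DL1_cL1 j (test_DL1_set u).
under eq_fun do rewrite (regular_shift _ _ _ mg).
apply: (@cintegral_dct _ _ _ (fun x => C * cabs (cderivn j u) x)).
- move=> n; apply: cmeasurableM; last by apply: continuous_cmeasurable;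
  case: u1.
  case: mg => m1 m2; split.
    exact: (measurableT_comp m1 (measurable_shift _)).
  exact: (measurableT_comp m2 (measurable_shift _)).
- move=> x.
  have := cvg_comp _ _ (gg' x) (@Rcomplex_mull_continuous R (cderivn j u x)
    (g' x)).
  rewrite /Rcomplex_mull mulrC; apply: cvg_trans; apply: near_eq_cvg.
  by apply: nearW => n /=; rewrite mulrC.
- by apply: integrableRZ; exact: cL1_integrable.
- by move=> n x; rewrite cmodM ler_wpM2r ?normr_ge0.
Qed.

Lemma regular_sum_translates n (f : 'I_n.+1 -> R -> R[i]) (s : nat -> R) :
  (forall j, almost_automorphic (f j)) ->
  exists2 k, subsequence k & exists2 S, is_distribution S &
    dcvg (fun l => dshift (s (k l)) (\sum_(j < n.+1) dderivn j (regular
      (f j)))) S /\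
    dcvg (fun l => dshift (- s (k l)) S) (\sum_(j < n.+1) dderivn j (regular
      (f j))).
Proof.
move=> aaf; have [k kS [g fg gf]] := almost_automorphic_common s aaf.
have /choice[C fC] : forall j, exists C, forall x, cmod (f j x) <= C.
  by move=> j; exact: almost_automorphic_bounded.
have mf j := aa_cmeasurable (aaf j).
have mg j : cmeasurable (g j).
  apply: (@cmeasurable_cvg _ (fun i x => f j (x + s (k i)))); last exact: fg.
  move=> i; case: (mf j) => m1 m2; split.
    exact: (measurableT_comp m1 (measurable_shift _)).
  exact: (measurableT_comp m2 (measurable_shift _)).
have gC j x : cmod (g j x) <= C j.
  have := @cmod_cvg_le _ _ (fun=> 0) _ 0 (C j) (fg j x) (cvg_cst _).
  by rewrite subr0; apply => i; rewrite subr0; exact: fC.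
have sumcvg (F : 'I_n.+1 -> nat -> Rcomplex R) (l : 'I_n.+1 -> Rcomplex R) :
   (forall j, F j i @[i --> \oo] --> l j) ->
   \sum_(j < n.+1) F j i @[i --> \oo] --> \sum_(j < n.+1) l j.
  move=> Fl; elim: (index_enum _) => [|j r IH].
    by rewrite big_nil; under eq_fun do rewrite big_nil; exact: cvg_cst.
  by rewrite big_cons; under eq_fun do rewrite big_cons; exact: cvgD.
(* Symmetric in the two families, so that it applies from f to g along s and back from g to f along
   -s. The bounds [C] serve for both, since they pass to pointwise limits. *)
have key (p q : 'I_n.+1 -> R -> R[i]) (h : nat -> R) :
    (forall j, cmeasurable (p j)) -> (forall j x, cmod (p j x) <= C j) ->
    (forall j x, (p j (x + h i) : Rcomplex R) @[i --> \oo] -->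
      (q j x : Rcomplex R)) ->
  dcvg (fun l => dshift (h l) (\sum_(j < n.+1) dderivn j (regular (p j))))
   (\sum_(j < n.+1) dderivn j (regular (q j))).
  move=> mp pC pq u; rewrite /dshift !fct_sumE.
  apply: sumcvg => j.
  apply: (cvg_comp _ _ (@regular_shift_cvg j h _ _ _ u (mp j) (pC j) (pq j))).
  exact: (@Rcomplex_mull_continuous R).
exists k => //; exists (\sum_(j < n.+1) dderivn j (regular (g j))).
  exact: regular_sum_distribution mg gC.
by split; apply: key.
Qed.

(** Near x0 the difference u(x - .) - u(x0 - .) stays supported in a fixed interval and all its
    derivatives are O(|x - x0|), so its norm is too. *)
Lemma translation_continuous m (V : (R -> R[i]) -> R[i]) u : bounded_form m V ->
  continuous ((fun x => V (fun y => u (x - y))) : R -> Rcomplex R).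
Proof.
move=> [lV [C C0 VC]] x0; have bV : bounded_form m V by split=> //; exists C.
have [su /compact_suppP[A uA]] := testfunP u.
have du := test_DL1_set u.
suff [K K0 HK] : exists2 K, 0 <= K & forall x, `|x - x0| < 1 ->
    sobolev m ((fun y => u (x - y)) - (fun y => u (x0 - y))) <= K * `|x - x0|.
  apply/cvgrPdist_le => e e0; near=> x.
  rewrite -[`|_|]/(cmod (V _ - V _)) cmodB.
  have x1 : `|x - x0| < 1.
    by rewrite distrC; near: x; apply: cvgr_dist_lt.
  rewrite -(bounded_formB bV); [|exact: DL1_reflect|exact: DL1_reflect].
  rewrite (le_trans (VC _ (DL1B (DL1_reflect x du) (DL1_reflect x0 du))))//.
  rewrite (le_trans (ler_wpM2l C0 (HK x x1)))// mulrA.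
  apply: (@le_trans _ _ ((C * K + 1) * `|x - x0|)).
    by rewrite ler_wpM2r// lerDl.
  rewrite mulrC -ler_pdivlMr ?ltr_wpDl ?mulr_ge0//.
  rewrite distrC; near: x; apply: cvgr_dist_le => //.
  by rewrite divr_gt0// ltr_wpDl// mulr_ge0.
have /choice[L HL] : forall i, exists L, forall x, cmod (cderivn i.+1 u x) <= L.
  by move=> i; have [_ /(_ i.+1)] := smooth_bounded_compact su uA.
have L0 i : 0 <= L i := le_trans (normr_ge0 _) (HL i 0).
(* For |x - x0| < 1 both reflected functions vanish outside [x0 - w, x0 + w]; the extra 1 absorbs
   the displacement. *)
pose w := `|A| + 1.
exists (\sum_(i < m.+1) (L i *+ 2) * (w + w)).
  by apply: sumr_ge0 => i _; rewrite mulr_ge0 ?mulrn_wge0// addr_ge0// addr_ge0.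
move=> x x1; rewrite /sobolev mulr_suml; apply: ler_sum => i _.
have sr t := smooth_reflect (x := t) su.
rewrite cderivn_sub// !cderivn_reflect// -scalerBr.
set z := (X in _ *: X).
have z1 : cL1 z /\ l1 z <= (L i *+ 2) * `|x - x0| * (w + w).
  have zE y : z y = cderivn i u (x - y) - cderivn i u (x0 - y) by [].
  have -> : w + w = (x0 + w) - (x0 - w) by ring.
  have Aw : A < w by rewrite /w (le_lt_trans (ler_norm _))// ltrDl.
  apply: l1_bump.
  - have -> : z = (-1 : R[i]) *: (fun y => cderivn i u (x0 - y)) +
    (fun y => cderivn i u (x - y)).
      by rewrite scaleN1r addrC.
    apply: smooth_continuousW; apply: smooth_lin; apply: smooth_reflect;
      exact: smooth_cderivn.
  - by rewrite lerD2l ge0_cp// addr_ge0.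
  - move=> y; rewrite zE.
    have := cderive_lipschitz (smooth_cderivn (n :=
      i) su) _ (x0 - y) (x - y) (K := L i).
    by rewrite cderivnD add1n opprB addrA subrK; apply.
  - move=> y yx; rewrite zE !(cderivn_eq0 _ uA) ?subrr// (lt_le_trans _
    (ler_norm _))//;
    by move: x1 yx (ler_norm A); rewrite /w ltr_norml => /andP[? ?] ? ?; lra.
  - move=> y yx; rewrite zE !(cderivn_eq0 _ uA) ?subrr// -normrN
    (lt_le_trans _ (ler_norm _))//;
    by move: x1 yx (ler_norm A); rewrite /w ltr_norml => /andP[? ?] ? ?; lra.
have [zL le] := z1; rewrite l1Z// cmod_sign mul1r (le_trans le)//.
by rewrite mulrAC.
Unshelve. all: by end_near. Qed.

Lemma dconv_almost_automorphic (T : testfun R -> R[i]) :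
  bounded_distribution T ->
  (forall s : nat -> R, exists2 k : nat -> nat, subsequence k &
      exists2 S : testfun R -> R[i], is_distribution S &
        dcvg (fun l => dshift (s (k l)) T) S /\
        dcvg (fun l => dshift (- s (k l)) S) T) ->
  forall u, almost_automorphic (dconv T u).
Proof.
move=> [U dU TU] TS u; split.
  have [m bV] := bounded_form_of_dual dU.
  have -> : dconv T u = (fun x => form_of_dual U (fun y => u (x - y))).
    by apply/funext => x; rewrite TU; apply/esym;
      exact: (form_of_dual_test U (reflect_test x u)).
  exact: translation_continuous bV.
move=> s; have [k kS [S _ [TSc STc]]] := TS s; exists k => //.
(* Translating the distribution by h moves the argument of its convolution with u from x to x + h,
   so the limit function is the convolution of [S] with u. *)
have E (h x : R) : shift_test (- h) (reflect_test x u) = reflect_test (x + h) u.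
  by apply: testfun_eq; apply/funext => y /=; congr (testfun_val u _); ring.
exists (fun x => S (reflect_test x u)) => x.
  have := TSc (reflect_test x u); rewrite /dshift.
  by under eq_fun do rewrite E.
have := STc (reflect_test x u); rewrite /dshift.
by under eq_fun do rewrite E.
Qed.

End implications.

Theorem theorem2 (R : realType) (T : testfun R -> R[i])
    (hT : bounded_distribution T) :
  [<->
    exists (n : nat) (f : 'I_n.+1 -> R -> R[i]),
      (forall j, almost_automorphic (f j)) /\
      T = \sum_(j < n.+1) dderivn j (regular (f j));
    forall s : nat -> R, exists2 k : nat -> nat, subsequence k &
      exists2 S : testfun R -> R[i], is_distribution S &
        dcvg (fun l => dshift (s (k l)) T) S /\
        dcvg (fun l => dshift (- s (k l)) S) T;
    forall u : testfun R, almost_automorphic (dconv T u)].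
Proof.
tfae.
- by move=> [n [f [aaf ->]]] s; exact: regular_sum_translates.
- exact: dconv_almost_automorphic.
- exact: bounded_distribution_representation.
Qed.
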